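(* Let $\alpha\ge0$, $\lambda\in\mathbb{R}$, $\theta\in[0,1]$, and let $Q$ be a nonnegative symmetric operator on $H=L^2((0,1);\mathbb{C})$ such that $Q^{1/2}$ is Hilbert--Schmidt on $H$. Let $u$ be the mild solution of the linear stochastic Schrödinger equation $$du=(\mathbf{i}\Delta u-\alpha u+\mathbf{i}\lambda u)\,dt+Q^{\frac12}dW,\qquad u(t,0)=u(t,1)=0,\qquad u(0)=u_0.$$ Let $\delta T>0$ with $\lambda\delta T<1$, $T_n=n\,\delta T$, and let $u_n^{(k)}$ be the parareal iterates with the exponential $\theta$-scheme as coarse propagator and the exact propagator $\mathcal{F}$ as fine propagator: $u_0^{(k)}=u_0$ for all $k\in\mathbb{N}$, and for $n\ge1$ $$u_n^{(0)}=\mathcal{G}_\theta(T_n,T_{n-1},u_{n-1}^{(0)}),\qquad u_n^{(k)}=\eta S(\delta T)u_{n-1}^{(k)}-\eta S(\delta T)u_{n-1}^{(k-1)}+\mathcal{F}(T_n,T_{n-1},u_{n-1}^{(k-1)}),\quad k\ge1 .$$ Then for a fixed iteration step $k\in\mathbb{N}$, $u_n^{(k)}$ approximates $u(T_n)$ with order $k$ in the following sense. (i) If $\alpha>\sqrt{\left(\frac12-\theta\right)^+}\,|\lambda|$, then $$\sup_{n\in\mathbb{N}}\big\|u(T_n)-u_n^{(k)}\big\|_{L^2(\Omega;H)}\le C\Big[|2\theta-1|\,\delta T^k+\delta T^{2k}\Big]\sup_{n\in\mathbb{N}}\big\|u(T_n)-u_n^{(0)}\big\|_{L^2(\Omega;H)}$$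 with a constant $C=C(k,\alpha,\theta,\lambda)$ independent of the time interval (and of $\delta T$). (ii) Otherwise, i.e. if $\alpha\le\sqrt{\left(\frac12-\theta\right)^+}\,|\lambda|$, for a fixed $N\in\mathbb{N}$ and $T_N=N\delta T$, $$\sup_{0\le n\le N}\big\|u(T_n)-u_n^{(k)}\big\|_{L^2(\Omega;H)}\le C\,\delta T^k\sup_{0\le n\le N}\big\|u(T_n)-u_n^{(0)}\big\|_{L^2(\Omega;H)}$$ where, for the given equation and $\theta$, the constant $C=C(T_N,k)$ depends on $T_N$ and $k$ but not otherwise on $\delta T$ and $N$. Here $\left(\frac12-\theta\right)^+:=\max\{\frac12-\theta,0\}$.
   Context: $H=L^2((0,1);\mathbb{C})$, $\mathbf{i}=\sqrt{-1}$, and $\Delta$ is the Dirichlet Laplacian on $(0,1)$ with eigenfunctions $e_m(x)=\sqrt2\sin(m\pi x)$, $m\ge1$. $W(t)=\sum_{m\ge1}e_m\beta_m(t)$ is a cylindrical Wiener process on a complete filtered probability space $(\Omega,\mathcal{B},\mathbb{P},\{\mathcal{B}_t\}_{t\ge0})$, where the $\beta_m$ are i.i.d. $\mathbb{C}$-valued Brownian motions (independent standard real and imaginary parts). The initial value $u_0$ is $\mathcal{B}_0$-measurable and in $L^2(\Omega;H)$. $\mathbb{N}$ includes $0$. $S(t):=e^{-t\Lambda}$ with $\Lambda:=-\mathbf{i}\Delta+\alpha$. The mild solution is $u(t)=S(t)u_0+\mathbf{i}\lambda\int_0^tS(t-s)u(s)\,ds+\int_0^tS(t-s)Q^{\frac12}dW(s)$.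 The exact propagator $\mathcal{F}(T_n,T_{n-1},v)$ is the value at time $T_n$ of the solution of the equation (driven by the same $W$) started from $v$ at time $T_{n-1}$. The coarse propagator (exponential $\theta$-scheme) is $$\mathcal{G}_\theta(T_n,T_{n-1},v):=(1+\mathbf{i}(1-\theta)\lambda\delta T)S_\theta S(\delta T)v+S_\theta S(\delta T)Q^{\frac12}\delta_nW,$$ with $S_\theta:=(1-\mathbf{i}\theta\lambda\delta T)^{-1}$ and $\delta_nW:=W(T_n)-W(T_{n-1})$, and $$\eta:=\frac{1+\mathbf{i}(1-\theta)\lambda\delta T}{1-\mathbf{i}\theta\lambda\delta T}.$$ *)

(* Defs.v *)
From HB Require Import structures.
From mathcomp Require Import all_boot all_order all_algebra.
From mathcomp Require Import generic_quotient ring_quotient.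
From mathcomp Require Import all_classical all_reals all_analysis.
From mathcomp Require Import measurable_realfun.
From mathcomp.real_closed Require Import complex.
Set Implicit Arguments.
Unset Strict Implicit.
Unset Printing Implicit Defensive.
Import Order.TTheory GRing.Theory Num.Theory numFieldNormedType.Exports.
Local Open Scope classical_set_scope.
Local Open Scope complex_scope.
Local Open Scope ring_scope.
Local Open Scope quotient_scope.

Local Notation Re := (@complex.Re _).
Local Notation Im := (@complex.Im _).

Section L2.
Context {R : realType}.

Definition unit_itv : set (measurableTypeR R) := `]0, 1[.

Lemma measurable_unit_itv : measurable unit_itv.
Proof. exact: measurable_itv. Qed.

Definition mu01 : {measure set (measurableTypeR R) -> \bar R} :=
  mrestr (@lebesgue_measure R) measurable_unit_itv.

Definition L2fun : {pred R -> R[i]} :=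
  [pred f | ((Re \o f : R -> R) \in Lfun mu01 2%:E)
         && ((Im \o f : R -> R) \in Lfun mu01 2%:E)].

Lemma L2fun_submod_closed : submod_closed L2fun.
Proof.
have p1 : (1 <= 2%:E :> \bar R)%E by rewrite lee1n.
have [h0 hD] := Lfun_submod_closed mu01 p1.
have hZ a (f : R -> R) : f \in Lfun mu01 2%:E ->
    (fun x => a * f x) \in Lfun mu01 2%:E.
  by move=> hf; have := hD a f 0 hf h0; rewrite addr0.
have hA (f g : R -> R) : f \in Lfun mu01 2%:E -> g \in Lfun mu01 2%:E ->
    (fun x => f x + g x) \in Lfun mu01 2%:E.
  by move=> hf hg; have := hD 1 f g hf hg; rewrite scale1r.
split=> [|a f g]; rewrite !inE/=.
  by apply/andP; split; exact: h0.
move=> /andP[fr fi] /andP[gr gi]; apply/andP; split.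
- have -> : @complex.Re R \o (a *: f + g) =
     fun x => (Re a * Re (f x) + (- Im a) * Im (f x)) + Re (g x).
    apply/funext => x /=; rewrite !fctE /GRing.scale /=.
    by case: (f x) (g x) a => [? ?] [? ?] [? ?] /=; rewrite mulNr.
  by apply: (hA) gr; apply: (hA (fun x => _) (fun x => _)); exact: hZ.
- have -> : @complex.Im R \o (a *: f + g) =
     fun x => (Re a * Im (f x) + Im a * Re (f x)) + Im (g x).
    apply/funext => x /=; rewrite !fctE /GRing.scale /=.
    by case: (f x) (g x) a => [? ?] [? ?] [? ?].
  by apply: (hA) gi; apply: (hA (fun x => _) (fun x => _)); exact: hZ.
Qed.

HB.instance Definition _ := GRing.isSubmodClosed.Build _ _ L2fun
  L2fun_submod_closed.

Record L2rep := MkL2rep { L2val :> R -> R[i]; _ : L2val \in L2fun }.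
HB.instance Definition _ := [isSub for L2val].
HB.instance Definition _ := [Choice of L2rep by <:].
HB.instance Definition _ := [SubChoice_isSubLmodule of L2rep by <:].

Definition L2null : {pred L2rep} := fun f =>
  `[< {ae mu01, forall x, f x = 0} >].

#[local] Instance ae_mu01 : Filter (almost_everywhere mu01).
Proof. exact: ae_filter_ringOfSetsType. Qed.

Lemma L2null_submod_closed : submod_closed L2null.
Proof.
split=> [|a f g]; rewrite !unfold_in; first by apply/asboolP/nearW.
move=> /asboolP f0 /asboolP g0; apply/asboolP.
apply: filterS2 f0 g0 => x fx gx.
by rewrite -[LHS]/(a *: f x + g x) fx gx scaler0 addr0.
Qed.
HB.instance Definition _ := GRing.isSubmodClosed.Build _ _ L2null
  L2null_submod_closed.

(* H = L^2((0,1); C).  Representatives are functions on the whole line, of which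
   only the values on (0,1) matter since mu01 does not charge the rest. *)
Definition L2C := Quotient.quot L2null.
HB.instance Definition _ := GRing.Zmodule.on L2C.

Definition L2class (f : L2rep) : L2C := \pi f.

Lemma L2classK (v : L2C) : L2class (repr v) = v.
Proof. exact: reprK. Qed.

Lemma L2class_eqP (f g : L2rep) :
  reflect (L2class f = L2class g) (f - g \in L2null).
Proof. by rewrite Quotient.idealrBE; exact: eqP. Qed.

Lemma L2classD (f g : L2rep) : L2class (f + g) = L2class f + L2class g.
Proof. exact: Quotient.pi_add. Qed.

Definition L2scale (a : R[i]) (v : L2C) : L2C := L2class (a *: repr v).

Lemma L2classZ a (f : L2rep) : L2scale a (L2class f) = L2class (a *: f).
Proof.
by apply/L2class_eqP; rewrite -scalerBr rpredZ//; exact/L2class_eqP/L2classK.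
Qed.

Lemma L2scaleA a b v : L2scale a (L2scale b v) = L2scale (a * b) v.
Proof. by rewrite -(L2classK v) !L2classZ scalerA. Qed.

Lemma L2scale1 : left_id 1 L2scale.
Proof. by move=> v; rewrite -(L2classK v) L2classZ scale1r. Qed.

Lemma L2scaleDr : right_distributive L2scale +%R.
Proof.
move=> a u v; rewrite -(L2classK u) -(L2classK v).
by rewrite !L2classZ -!L2classD L2classZ scalerDr.
Qed.

Lemma L2scaleDl v : {morph L2scale^~ v : a b / a + b}.
Proof. by move=> a b; rewrite -(L2classK v) !L2classZ -L2classD scalerDl. Qed.

HB.instance Definition _ := GRing.Zmodule_isLmodule.Build R[i] L2C
  L2scaleA L2scale1 L2scaleDr L2scaleDl.

Lemma sine_L2fun (m : nat) :
  (fun x : R => (Num.sqrt 2 * sin (m%:R * pi * x))%:C) \in L2fun.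
Proof.
set g := fun x : R => Num.sqrt 2 * sin (m%:R * pi * x).
rewrite !inE; apply/andP; split; last first.
  rewrite (_ : _ \o _ = 0); first exact: (Lfun_submod_closed mu01 (lee1n 2)).1.
  by apply/funext => x.
rewrite (_ : _ \o _ = g) ?inE; last by apply/funext => x.
have mg : measurable_fun setT g.
  apply: continuous_measurable_fun => x.
  apply: cvgM; first exact: cvg_cst.
  apply: (continuous_comp (f := fun y : R => m%:R * pi * y)).
    exact: mulrl_continuous.
  exact: continuous_sin.
apply/andP; split; rewrite inE//.
rewrite /= /finite_norm unlock poweR_lty//.
have mu1 : (mu01 setT < +oo)%E.
  rewrite /mu01 /mrestr /= /mrestr setTI /unit_itv lebesgue_measure_itv/=.
  by rewrite lte01 ltry.
apply: (@le_lt_trans _ _ (\int[mu01]_x (cst (2 : R)%:E x))%E); last first.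
  by rewrite integral_cst// lte_mul_pinfty.
apply: ge0_le_integral => //=.
- apply/measurable_EFinP; rewrite (_ : (fun x => _) = fun x => `|g x| ^+ 2).
    by apply: measurable_funX; exact: measurableT_comp.
  by apply/funext => x; rewrite powR_mulrn.
- move=> x _; rewrite lee_fin powR_mulrn// normrM exprMn ger0_norm ?sqrtr_ge0//.
  by rewrite sqr_sqrtr// ler_piMr// exprn_ile1// sin_max.
Qed.

Definition sine_basis (m : nat) : L2C := L2class (MkL2rep (sine_L2fun m)).

Definition L2inner (f g : L2C) : R[i] :=
  (\int[mu01]_x Re (repr f x * ((repr g x)^*)%C)) +i*
  (\int[mu01]_x Im (repr f x * ((repr g x)^*)%C)).

Definition L2norm (f : L2C) : R := Num.sqrt (Re (L2inner f f)).

Definition cvgL2 (u : nat -> L2C) (f : L2C) : Prop :=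
  (fun n => L2norm (u n - f)) @ \oo --> (0 : R).

Definition openL2 (U : set L2C) : Prop := forall f, U f ->
  exists2 r : R, 0 < r & forall g, L2norm (g - f) < r -> U g.

(* Borel measurability with respect to a sigma-algebra G. *)
Definition measurableL2 T (G : set (set T)) (X : T -> L2C) : Prop :=
  forall U, openL2 U -> G (X @^-1` U).

(* The integral over [a, b] of an H-valued function: J is determined by
   <J, h> = int <f(r), h> dr for all h in H; as H is separable and ||f|| is
   required to be integrable, this is the Bochner integral. *)
Definition is_L2integral (a b : R) (f : R -> L2C) (J : L2C) : Prop :=
  [/\ (@lebesgue_measure R).-integrable `[a, b] (EFin \o L2norm \o f),
      forall h, (@lebesgue_measure R).-integrable `[a, b]
        (fun r => (Re (L2inner (f r) h))%:E),
      forall h, (@lebesgue_measure R).-integrable `[a, b]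
        (fun r => (Im (L2inner (f r) h))%:E) &
      forall h, L2inner J h =
        (\int[lebesgue_measure]_(r in `[a, b]) Re (L2inner (f r) h)) +i*
        (\int[lebesgue_measure]_(r in `[a, b]) Im (L2inner (f r) h))].

Definition nonneg_symmetric (A : L2C -> L2C) : Prop :=
  (forall f g, L2inner (A f) g = L2inner f (A g)) /\
  (forall f, 0 <= L2inner (A f) f).

Definition is_op_sqrt (Q Qh : L2C -> L2C) : Prop :=
  nonneg_symmetric Qh /\ forall f, Qh (Qh f) = Q f.

Definition hilbert_schmidt (A : L2C -> L2C) : Prop :=
  (\sum_(1 <= m <oo) (L2norm (A (sine_basis m)) ^+ 2)%:E < +oo)%E.

Definition Cexp (z : R[i]) : R[i] :=
  (expR (Re z) * cos (Im z)) +i* (expR (Re z) * sin (Im z)).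

(* The eigenvalue of Lambda = - i Delta + alpha at sine_basis m, where Delta is
   the Dirichlet Laplacian: Delta e_m = - (m pi)^2 e_m. *)
Definition Lambda_eigenvalue (alpha : R) (m : nat) : R[i] :=
  alpha +i* ((m%:R * pi) ^+ 2).

(* S(t) = exp (- t Lambda), by the expansion in the eigenfunctions. *)
Definition is_semigroup (alpha : R) (S : R -> L2C -> L2C) : Prop :=
  forall t f, 0 <= t ->
  cvgL2 (fun n => \sum_(1 <= m < n.+1)
    (Cexp (- (t%:C * Lambda_eigenvalue alpha m)) * L2inner f (sine_basis m))
      *: sine_basis m) (S t f).

End L2.

Arguments L2C : clear implicits.

Section stochastic.
Context {R : realType} {d : measure_display} {Om : measurableType d}.
Variable P : probability Om R.
Local Notation H := (L2C R).

(* The norm of L^2(Omega; H), +oo when E ||X||^2 is infinite. *)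
Definition L2Om_norm (X : Om -> H) : \bar R :=
  'N[P]_2%:E[EFin \o L2norm \o X]%E.

Record complete_filtration (B : R -> set (set Om)) : Prop := {
  cf_complete : measure_is_complete P ;
  cf_sigma : forall t, 0 <= t -> sigma_algebra setT (B t) ;
  cf_sub : forall t, 0 <= t -> B t `<=` measurable ;
  cf_mono : forall s t, 0 <= s -> s <= t -> B s `<=` B t ;
  cf_null : P.-negligible `<=` B 0 }.

(* The family (beta m)_{m >= 1} of independent complex B-Brownian motions
   representing the cylindrical Wiener process W = sum_m e_m beta_m.  cw_incr
   says at once that the real and imaginary parts of the increments over (s, t]
   are N(0, t - s), that they are mutually independent, over m also, and that
   they are independent of B s. *)
Record cylindrical_wiener (B : R -> set (set Om))
    (beta : nat -> R -> Om -> R[i]) : Prop := {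
  cw_zero : forall m, (0 < m)%N -> \forall w \ae P, beta m 0 w = 0 ;
  cw_cont : forall m, (0 < m)%N -> \forall w \ae P,
    {within [set t : R | 0 <= t], continuous (fun t => Re (beta m t w))} /\
    {within [set t : R | 0 <= t], continuous (fun t => Im (beta m t w))} ;
  cw_adapted : forall m t, (0 < m)%N -> 0 <= t ->
    forall A : set (measurableTypeR R), measurable A ->
    B t [set w | A (Re (beta m t w))] /\ B t [set w | A (Im (beta m t w))] ;
  cw_incr : forall s t, 0 <= s -> s < t -> forall A, B s A ->
    forall n (A1 A2 : nat -> set (measurableTypeR R)),
    (forall m, measurable (A1 m)) -> (forall m, measurable (A2 m)) ->
    P (A `&` \bigcap_(m in [set m | (1 <= m <= n)%N])
         [set w | A1 m (Re (beta m t w - beta m s w)) /\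
                  A2 m (Im (beta m t w - beta m s w))]) =
    (P A * \prod_(1 <= m < n.+1)
       (normal_prob 0 (Num.sqrt (t - s)) (A1 m) *
        normal_prob 0 (Num.sqrt (t - s)) (A2 m)))%E }.

(* An elementary operator-valued integrand is a finite sum of terms
     r |-> 1_(a, b](r) <., e_m> h ,
   the stochastic integral of which is (beta_m(b) - beta_m(a)) h. *)
Record elem_term := ElemTerm { et_m : nat ; et_a : R ; et_b : R ; et_h : H }.

Definition elem_on (s t : R) (E : seq elem_term) : bool :=
  all (fun x => [&& (0 < et_m x)%N, s <= et_a x, et_a x <= et_b x &
                    et_b x <= t]) E.

(* E(r) e_m *)
Definition elem_apply (E : seq elem_term) (r : R) (m : nat) : H :=
  \sum_(x <- E | (et_m x == m) && (et_a x < r <= et_b x)) et_h x.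

Definition elem_integral (beta : nat -> R -> Om -> R[i]) (E : seq elem_term)
    (w : Om) : H :=
  \sum_(x <- E) (beta (et_m x) (et_b x) w - beta (et_m x) (et_a x) w) *: et_h x.

(* The squared distance in L^2(s, t; HS(H)). *)
Definition elem_dist2 (s t : R) (Phi : R -> H -> H) (E : seq elem_term)
    : \bar R :=
  (\sum_(1 <= m <oo) \int[lebesgue_measure]_(r in `[s, t])
     (L2norm (Phi r (sine_basis m) - elem_apply E r m) ^+ 2)%:E)%E.

(* Z is the integral of the deterministic integrand Phi with respect to W over
   [s, t]: Phi lies in the closure of the elementary integrands, and Z is the
   limit in L^2(Omega; H) of their integrals as they tend to Phi. *)
Record is_wiener_integral (beta : nat -> R -> Om -> R[i]) (s t : R)
    (Phi : R -> H -> H) (Z : Om -> H) : Prop := {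
  wi_meas : measurableL2 measurable Z ;
  wi_dense : forall delta : R, 0 < delta ->
    exists2 E, elem_on s t E & (elem_dist2 s t Phi E < delta%:E)%E ;
  wi_lim : forall eps : R, 0 < eps -> exists2 delta : R, 0 < delta &
    forall E, elem_on s t E -> (elem_dist2 s t Phi E < delta%:E)%E ->
    (L2Om_norm (fun w => (Z w - elem_integral beta E w)%R) < eps%:E)%E }.

(* Z = Q^{1/2} (W(t) - W(s)), by the expansion of W. *)
Definition is_noise_increment (beta : nat -> R -> Om -> R[i]) (Qh : H -> H)
    (s t : R) (Z : Om -> H) : Prop :=
  measurableL2 measurable Z /\
  (fun n => L2Om_norm (fun w => Z w - \sum_(1 <= m < n.+1)
     (beta m t w - beta m s w) *: Qh (sine_basis m))) @ \oo --> (0 : \bar R).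

Variables (B : R -> set (set Om)) (beta : nat -> R -> Om -> R[i]).
Variables (S : R -> H -> H) (Qh : H -> H) (lambda : R).

(* The mild solution on [s, +oo) with value v at time s. *)
Record mild_solution (s : R) (v : Om -> H) (X : R -> Om -> H) : Prop := {
  ms_adapted : forall t, s <= t -> measurableL2 (B t) (X t) ;
  ms_meas : forall U, openL2 U -> measurable
    [set z : measurableTypeR R * Om | s <= z.1 /\ U (X z.1 z.2)] ;
  ms_eq : forall t, s <= t ->
    exists2 Z, is_wiener_integral beta s t (fun r f => S (t - r) (Qh f)) Z &
    \forall w \ae P,
    exists2 J, is_L2integral s t (fun r => S (t - r) (X r w)) J &
    X t w = S (t - s) (v w) + (0 +i* lambda) *: J + Z w }.

(* w = F(T1, T0, v), up to a null set *)
Definition exact_propagator (T1 T0 : R) (v w : Om -> H) : Prop :=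
  exists2 X, mild_solution T0 v X & \forall o \ae P, w o = X T1 o.

Variables (theta dT : R).

Definition S_theta : R[i] := (1 -i* (theta * lambda * dT))^-1.

Definition eta : R[i] :=
  (1 +i* ((1 - theta) * lambda * dT)) / (1 -i* (theta * lambda * dT)).

(* w = G_theta(T_{n+1}, T_n, v), up to a null set *)
Definition coarse_propagator (n : nat) (v w : Om -> H) : Prop :=
  exists2 Z, is_noise_increment beta Qh (n%:R * dT) (n.+1%:R * dT) Z &
  \forall o \ae P, w o =
    ((1 +i* ((1 - theta) * lambda * dT)) * S_theta) *: S dT (v o) +
    S_theta *: S dT (Z o).

(* U k n is the iterate u_n^{(k)}. *)
Record parareal (u0 : Om -> H) (U : nat -> nat -> Om -> H) : Prop := {
  pr_init : forall k, U k 0%N = u0 ;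
  pr_coarse : forall n, coarse_propagator n (U 0%N n) (U 0%N n.+1) ;
  pr_correct : forall k n,
    exists2 w, exact_propagator (n.+1%:R * dT) (n%:R * dT) (U k n) w &
    \forall o \ae P, U k.+1 n.+1 o =
      eta *: S dT (U k.+1 n o) - eta *: S dT (U k n o) + w o }.

End stochastic.

(* All the data of the equation, with its mild solution u. *)
Record schrodinger_problem (R : realType) (alpha lambda : R)
    (d : measure_display) (Om : measurableType d) (P : probability Om R)
    (B : R -> set (set Om)) (beta : nat -> R -> Om -> R[i])
    (S : R -> L2C R -> L2C R) (Q Qh : {linear L2C R -> L2C R})
    (u0 : Om -> L2C R) (u : R -> Om -> L2C R) : Prop := {
  sp_filtration : complete_filtration P B ;
  sp_wiener : cylindrical_wiener P B beta ;
  sp_semigroup : is_semigroup alpha S ;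
  sp_Q : nonneg_symmetric Q ;
  sp_sqrt : is_op_sqrt Q Qh ;
  sp_hs : hilbert_schmidt Qh ;
  sp_u0_meas : measurableL2 (B 0) u0 ;
  sp_u0_L2 : (L2Om_norm P u0 < +oo)%E ;
  sp_mild : mild_solution P B beta S Qh lambda 0 u0 u }.

(* Main.v *)
(** The error [e k n = u(T_n) - u_n^(k)] obeys, with [x = lambda dT],
    [e (k+1) (n+1) = (exp(i x) - eta) S(dT) (e k n) + eta S(dT) (e (k+1) n)],
    because two mild solutions driven by the same noise differ by
    [exp(i lambda t) S(t)] applied to the difference of their initial values.
    Since [|exp(i x) - eta| <= |2 theta - 1| x^2 + 3 |x|^3] and [S] contracts by
    [exp(- alpha dT)], summing this recursion in [n] gains one factor
    [|2 theta - 1| dT + dT^2] per iteration when [|eta| exp(- alpha dT) < 1]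
    stays far enough from 1 (which is what the threshold on [alpha] means, as
    [|eta|^2 <= 1 + 2 (1/2 - theta)^+ x^2]), and one factor [dT] on a bounded
    time interval.

    The difference formula is proved coordinatewise in the sine basis: after
    removing the free evolution, a coordinate [D] of the difference satisfies
    [D(t) = D(s) + i lambda int_s^t D] almost surely for each [t], hence by
    Fubini almost surely for almost every [t], which forces
    [D(t) = exp(i lambda (t - s)) D(s)].  That coordinates determine a vector is
    the completeness of the sines, which also gives [S(0) = id]: the expansion
    defining [S] does not assume it. *)

Require Import Defs.
From HB Require Import structures.
From mathcomp Require Import all_boot all_order all_algebra.
From mathcomp Require Import all_classical all_reals all_analysis.
From mathcomp Require Import measurable_realfun ring lra.
From mathcomp.real_closed Require Import complex.
Set Implicit Arguments.
Unset Strict Implicit.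
Unset Printing Implicit Defensive.
Import Order.TTheory GRing.Theory Num.Theory numFieldNormedType.Exports.
Local Open Scope classical_set_scope.
Local Open Scope complex_scope.
Local Open Scope ring_scope.

Local Notation Re := (@complex.Re _).
Local Notation Im := (@complex.Im _).
Local Notation normc := ComplexField.Normc.normc.
Arguments L2inner {R} f g : simpl never.

(** * Complex-valued integrals and the inner product of H *)

(** The solution [u] starts at time 0, a propagator at [T_n], and stochastic integrals are known
    only as limits of elementary ones, each up to a null set. That both see the same noise is thus a
    statement to prove: the convolution over [0, t] is [S (t - s)] of the one over [0, s] plus the
    one over [s, t]. After that the noise cancels, the error recursion is pathwise, and the triangle
    inequality in L^2(Omega; H) suffices.

    A mild solution comes without continuous paths, and its equation holds off a null set depending
    on the time. The rotation is therefore found for the right-hand side of the integral equation,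
    which is continuous, and carried to the time wanted by the equation at that time.

    Completeness rests on two facts: [sin (pi x)] times a polynomial in [cos (pi x)] is a finite sum
    of sines, and such polynomials tend boundedly to indicators of half-lines on (0, 1).

    The threshold enters by matching second-order terms: with [z = alpha dT],
    [exp (2 z) >= 1 + 2 z + 2 z^2], and [alpha^2 >= (1/2 - theta)^+ lambda^2] gives
    [|eta|^2 <= 1 + 2 z^2]. The quadratic terms cancel and a gap [2 z], linear in [dT], remains. *)

Lemma cReD (R : realType) (z w : R[i]) : Re (z + w) = Re z + Re w.
Proof. by case: z w => [? ?] []. Qed.
Lemma cImD (R : realType) (z w : R[i]) : Im (z + w) = Im z + Im w.
Proof. by case: z w => [? ?] []. Qed.
Lemma cReM (R : realType) (z w : R[i]) : Re (z * w) = Re z * Re w - Im z * Im w.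
Proof. by case: z w => [? ?] []. Qed.
Lemma cImM (R : realType) (z w : R[i]) : Im (z * w) = Re z * Im w + Im z * Re w.
Proof. by case: z w => [? ?] []. Qed.
Lemma cReN (R : realType) (z : R[i]) : Re (- z) = - Re z.
Proof. by case: z. Qed.
Lemma cImN (R : realType) (z : R[i]) : Im (- z) = - Im z.
Proof. by case: z. Qed.
Lemma cRe_conj (R : realType) (z : R[i]) : Re z^* = Re z.
Proof. by case: z. Qed.
Lemma cIm_conj (R : realType) (z : R[i]) : Im z^* = - Im z.
Proof. by case: z. Qed.
Definition ReImE := (cReD, cImD, cReM, cImM, cReN, cImN, cRe_conj, cIm_conj).

Lemma complex_ext (R : realType) (z w : R[i]) : Re z = Re w -> Im z = Im w -> z = w.
Proof. by case: z w => [a b] [c e] /= -> ->. Qed.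

Lemma normc_sqr (R : realType) (z : R[i]) : normc z ^+ 2 = Re z ^+ 2 + Im z ^+ 2.
Proof. by case: z => a b /=; rewrite sqr_sqrtr// addr_ge0// sqr_ge0. Qed.

Lemma normc_ge0 (R : realType) (z : R[i]) : 0 <= normc z.
Proof. by case: z => a b; exact: sqrtr_ge0. Qed.

Lemma Re_mul_conj (R : realType) (z : R[i]) : z * z^* = (normc z ^+ 2)%:C.
Proof. by rewrite normc_sqr; apply: complex_ext; rewrite !ReImE/=; ring. Qed.

Section ae.
Context {d} {T : measurableType d} {R : realType}.
Variable mu : {measure set T -> \bar R}.

Lemma ae_imp (p q : T -> Prop) : (forall x, p x -> q x) ->
  {ae mu, forall x, p x} -> {ae mu, forall x, q x}.
Proof. by move=> pq; apply: filterS. Qed.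

Lemma ae_imp2 (p q r : T -> Prop) : (forall x, p x -> q x -> r x) ->
  {ae mu, forall x, p x} -> {ae mu, forall x, q x} -> {ae mu, forall x, r x}.
Proof. by move=> pq; apply: filterS2. Qed.

Lemma ae_imp3 (p q r s : T -> Prop) : (forall x, p x -> q x -> r x -> s x) ->
  {ae mu, forall x, p x} -> {ae mu, forall x, q x} -> {ae mu, forall x, r x} ->
  {ae mu, forall x, s x}.
Proof. by move=> pq; apply: filterS3. Qed.

End ae.

Section cintegral.
Context {d} {T : measurableType d} {R : realType}.
Variable mu : {measure set T -> \bar R}.
Implicit Types (D : set T) (f g : T -> R[i]).

Definition cintegrable D f :=
  mu.-integrable D (fun x => (Re (f x))%:E) /\
  mu.-integrable D (fun x => (Im (f x))%:E).

(** This is literally the shape of the right-hand sides in [L2inner] and [is_L2integral], so both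
    are instances of it by conversion. *)
Definition cintegral D f : R[i] :=
  (\int[mu]_(x in D) Re (f x)) +i* (\int[mu]_(x in D) Im (f x)).

Lemma integrable_lin D (f g : T -> R) a b : measurable D ->
  mu.-integrable D (EFin \o f) -> mu.-integrable D (EFin \o g) ->
  mu.-integrable D (EFin \o (fun x => a * f x + b * g x)).
Proof.
move=> mD hf hg.
have := integrableD mD (integrableZl mD a hf) (integrableZl mD b hg).
by apply: eq_integrable => // x _ /=; rewrite EFinD !EFinM.
Qed.

Lemma Rintegral_lin D (f g : T -> R) a b : measurable D ->
  mu.-integrable D (EFin \o f) -> mu.-integrable D (EFin \o g) ->
  \int[mu]_(x in D) (a * f x + b * g x) =
  a * \int[mu]_(x in D) f x + b * \int[mu]_(x in D) g x.
Proof.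
move=> mD hf hg; rewrite RintegralD//.
- by rewrite !RintegralZl.
- exact: (eq_integrable mD _ _ _ (integrableZl mD a hf)).
- exact: (eq_integrable mD _ _ _ (integrableZl mD b hg)).
Qed.

Lemma cintegrableD D f g : measurable D -> cintegrable D f -> cintegrable D g ->
  cintegrable D (fun x => f x + g x).
Proof.
move=> mD [fr fi] [gr gi]; split.
- apply: eq_integrable (integrableD mD fr gr) => // x _ /=.
  by rewrite cReD EFinD.
- apply: eq_integrable (integrableD mD fi gi) => // x _ /=.
  by rewrite cImD EFinD.
Qed.

Lemma cintegrableZ D c f : measurable D -> cintegrable D f ->
  cintegrable D (fun x => c * f x).
Proof.
move=> mD [fr fi]; split.
- apply: eq_integrable (integrable_lin (Re c) (- Im c) mD fr fi) => // x _ /=.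
  by rewrite cReM mulNr.
- apply: eq_integrable (integrable_lin (Re c) (Im c) mD fi fr) => // x _ /=.
  by rewrite cImM.
Qed.

Lemma cintegralD D f g : measurable D -> cintegrable D f -> cintegrable D g ->
  cintegral D (fun x => f x + g x) = cintegral D f + cintegral D g.
Proof.
move=> mD [fr fi] [gr gi]; apply: complex_ext; rewrite !ReImE /= -RintegralD//.
- by apply: eq_Rintegral => x _; rewrite cReD.
- by apply: eq_Rintegral => x _; rewrite cImD.
Qed.

Lemma cintegralZ D c f : measurable D -> cintegrable D f ->
  cintegral D (fun x => c * f x) = c * cintegral D f.
Proof.
move=> mD [fr fi]; apply: complex_ext; rewrite !ReImE /= -?mulNr -Rintegral_lin//.
- by apply: eq_Rintegral => x _; rewrite cReM mulNr.
- by apply: eq_Rintegral => x _; rewrite cImM.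
Qed.

Lemma cintegral_conj D f : measurable D -> cintegrable D f ->
  cintegral D (fun x => (f x)^*) = (cintegral D f)^*.
Proof.
move=> mD [fr fi]; apply: complex_ext; rewrite !ReImE /=.
- by apply: eq_Rintegral => x _; rewrite cRe_conj.
- rewrite -mulN1r -RintegralZl//.
  by apply: eq_Rintegral => x _; rewrite cIm_conj mulN1r.
Qed.

Lemma eq_cintegral D f g : {in D, f =1 g} -> cintegral D f = cintegral D g.
Proof.
by move=> fg; congr Complex; apply: eq_Rintegral => x xD; rewrite fg.
Qed.

Lemma eq_cintegrable D f g : measurable D -> {in D, f =1 g} ->
  cintegrable D f -> cintegrable D g.
Proof.
by move=> mD fg [fr fi]; split;
  [apply: eq_integrable fr|apply: eq_integrable fi] => // x xD; rewrite fg.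
Qed.

Lemma cintegrableS (D E : set T) f : measurable E -> measurable D ->
  D `<=` E -> cintegrable E f -> cintegrable D f.
Proof. by move=> mE mD DE [fr fi]; split; exact: integrableS DE _. Qed.

Lemma ae_eq_cintegral D f g : measurable D -> cintegrable D f ->
  cintegrable D g -> {ae mu, forall x, D x -> f x = g x} ->
  cintegral D f = cintegral D g.
Proof.
move=> mD [fr fi] [gr gi] fg.
congr Complex; congr fine; apply: ae_eq_integral => //; first exact: measurable_int fr.
- exact: measurable_int gr.
- by apply: filterS fg => x fg Dx; rewrite fg.
- exact: measurable_int fi.
- exact: measurable_int gi.
- by apply: filterS fg => x fg Dx; rewrite fg.
Qed.

End cintegral.

Section inner.
Context {R : realType}.
Local Notation H := (L2C R).
Local Notation mu := (@mu01 R).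
Implicit Types (f g h : H) (a : R[i]).

#[local] Instance ae_mu01 : Filter (almost_everywhere mu).
Proof. exact: ae_filter_ringOfSetsType. Qed.

Lemma L2val_Lfun (f : @L2rep R) :
  ((fun x => Re (L2val f x)) \in Lfun mu 2%:E) *
  ((fun x => Im (L2val f x)) \in Lfun mu 2%:E).
Proof.
by case: f => f hf; have := hf; rewrite !inE /= => /andP[? ?]; split.
Qed.

Lemma integrableM_Lfun2 (f g : R -> R) : f \in Lfun mu 2%:E ->
  g \in Lfun mu 2%:E -> mu.-integrable setT (EFin \o (fun x => f x * g x)).
Proof. by move=> hf hg; apply/Lfun1_integrable; exact: Lfun2_mul_Lfun1. Qed.

Lemma cintegrable_inner (f g : @L2rep R) :
  cintegrable mu setT (fun x => L2val f x * (L2val g x)^*).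
Proof.
have [[fr fi] [gr gi]] := (L2val_Lfun f, L2val_Lfun g).
split.
- apply: eq_integrable (integrable_lin 1 1 measurableT
    (integrableM_Lfun2 fr gr) (integrableM_Lfun2 fi gi)) => //= x _ /=.
  by congr EFin; rewrite !ReImE; ring.
- apply: eq_integrable (integrable_lin (-1) 1 measurableT
    (integrableM_Lfun2 fr gi) (integrableM_Lfun2 fi gr)) => //= x _ /=.
  by congr EFin; rewrite !ReImE; ring.
Qed.

Lemma repr_L2class (f : @L2rep R) :
  {ae mu, forall x, L2val (repr (L2class f)) x = L2val f x}.
Proof.
have /L2class_eqP := L2classK (L2class f).
rewrite unfold_in => /asboolP; apply: filterS => x h.
by apply/eqP; rewrite -subr_eq0 -[X in X == _]/(L2val (repr (L2class f) - f) x) h.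
Qed.

(** [L2inner] is defined on the representatives picked by [repr]; these agree almost everywhere with
    any others, so any may be used. All algebraic laws of the inner product go through this. *)
Lemma L2inner_class (f g : @L2rep R) : L2inner (L2class f) (L2class g) =
  cintegral mu setT (fun x => L2val f x * (L2val g x)^*).
Proof.
apply: ae_eq_cintegral => //; [exact: cintegrable_inner..|].
by apply: filterS2 (repr_L2class f) (repr_L2class g) => x -> ->.
Qed.

Lemma L2inner_conj f g : L2inner g f = (L2inner f g)^*.
Proof.
rewrite -[LHS]/(cintegral mu setT (fun x => L2val (repr g) x * (L2val (repr f) x)^*)).
rewrite -[in RHS](L2classK f) -[in RHS](L2classK g) L2inner_class -cintegral_conj//.
- apply: eq_cintegral => x _.
  by apply: complex_ext; rewrite !ReImE; ring.
- exact: cintegrable_inner.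
Qed.

Lemma L2innerDl f g h : L2inner (f + g) h = L2inner f h + L2inner g h.
Proof.
rewrite -(L2classK f) -(L2classK g) -(L2classK h) -L2classD !L2inner_class.
rewrite -cintegralD//; try exact: cintegrable_inner.
by apply: eq_cintegral => x _ /=; rewrite -mulrDl.
Qed.

Lemma L2innerZl a f h : L2inner (a *: f) h = a * L2inner f h.
Proof.
rewrite -(L2classK f) -(L2classK h) -[_ *: _]/(L2scale _ _) L2classZ !L2inner_class.
rewrite -cintegralZ//; try exact: cintegrable_inner.
by apply: eq_cintegral => x _ /=; rewrite mulrA.
Qed.

Lemma L2innerNl f h : L2inner (- f) h = - L2inner f h.
Proof. by rewrite -scaleN1r L2innerZl mulN1r. Qed.

Lemma L2innerBl f g h : L2inner (f - g) h = L2inner f h - L2inner g h.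
Proof. by rewrite L2innerDl L2innerNl. Qed.

Lemma L2inner0l h : L2inner 0 h = 0.
Proof. by rewrite -(scale0r 0) L2innerZl mul0r. Qed.

Lemma L2inner_suml (I : Type) (r : seq I) (p : pred I) (F : I -> H) h :
  L2inner (\sum_(i <- r | p i) F i) h = \sum_(i <- r | p i) L2inner (F i) h.
Proof.
elim/big_ind2 : _ => //; first by rewrite L2inner0l.
by move=> ? ? ? ? <- <-; rewrite L2innerDl.
Qed.

Lemma L2innerDr h f g : L2inner h (f + g) = L2inner h f + L2inner h g.
Proof. by rewrite L2inner_conj L2innerDl rmorphD/= -!L2inner_conj. Qed.

Lemma L2innerZr a f h : L2inner h (a *: f) = a^* * L2inner h f.
Proof. by rewrite L2inner_conj L2innerZl rmorphM/= -!L2inner_conj. Qed.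

Lemma L2innerNr f h : L2inner h (- f) = - L2inner h f.
Proof. by rewrite L2inner_conj L2innerNl rmorphN/= -!L2inner_conj. Qed.

Lemma L2inner0r h : L2inner h 0 = 0.
Proof. by rewrite L2inner_conj L2inner0l rmorph0. Qed.

Lemma L2inner_sumr (I : Type) (r : seq I) (p : pred I) (F : I -> H) h :
  L2inner h (\sum_(i <- r | p i) F i) = \sum_(i <- r | p i) L2inner h (F i).
Proof.
elim/big_ind2 : _ => //; first by rewrite L2inner0r.
by move=> ? ? ? ? <- <-; rewrite L2innerDr.
Qed.

Lemma ReL2inner_ge0 f : 0 <= Re (L2inner f f).
Proof.
apply: Rintegral_ge0 => x _.
by rewrite Re_mul_conj /= sqr_ge0.
Qed.

Lemma L2norm_ge0 f : 0 <= L2norm f. Proof. exact: sqrtr_ge0. Qed.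

Lemma sqr_L2norm f : L2norm f ^+ 2 = Re (L2inner f f).
Proof. by rewrite sqr_sqrtr// ReL2inner_ge0. Qed.

Lemma L2innerff f : L2inner f f = (L2norm f ^+ 2)%:C.
Proof.
apply: complex_ext; first by rewrite sqr_L2norm.
have := congr1 Im (L2inner_conj f f); rewrite cIm_conj.
rewrite [Im (_%:C)]/= -/(@mu01 R); set y := Im _; lra.
Qed.

Lemma L2norm0_eq0 f : L2norm f = 0 -> f = 0.
Proof.
move=> f0; have : Re (L2inner f f) = 0 by rewrite -sqr_L2norm f0 expr0n.
rewrite -(L2classK f) L2inner_class/= => h.
have [ir _] := cintegrable_inner (repr f) (repr f).
have : (\int[mu]_x `|(Re (L2val (repr f) x * (L2val (repr f) x)^*))%:E| = 0)%E.
  transitivity (\int[mu]_x (Re (L2val (repr f) x * (L2val (repr f) x)^*))%:E)%E.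
    apply: eq_integral => x _.
    by rewrite gee0_abs// lee_fin Re_mul_conj/= sqr_ge0.
  rewrite -[LHS]fineK; last exact: integrable_fin_num.
  by congr EFin.
have /= mr := measurable_int _ ir.
move/(ae_eq_integral_abs _ measurableT mr) => h0.
apply/esym; rewrite -(L2classK 0); apply/L2class_eqP.
have e : {ae mu, forall x, L2val (repr f) x = 0}.
  apply: filterS h0 => x /(_ I) [] /eqP.
  rewrite Re_mul_conj/= sqrf_eq0 => /eqP.
  exact: ComplexField.Normc.eq0_normc.
rewrite unfold_in; apply/asboolP.
(* The representative chosen for the class 0 need not be the zero function; it only vanishes almost
   everywhere. *)
have z : {ae mu, forall x, L2val (repr (0 : H)) x = 0}.
  have /L2class_eqP : L2class (repr (0 : H)) = L2class 0.
    rewrite L2classK -[0 in LHS](scale0r 0) -[_ *: _]/(L2scale _ _) -(L2classK 0).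
    by rewrite L2classZ scale0r.
  by rewrite subr0 unfold_in => /asboolP.
apply: filterS2 e z => x e z.
by rewrite -[LHS]/(L2val (repr (0:H)) x - L2val (repr f) x) e z subr0.
Qed.

Lemma L2norm0 : L2norm (0 : H) = 0.
Proof. by rewrite /L2norm L2inner0l sqrtr0. Qed.

Lemma sqr_L2normZ a f : L2norm (a *: f) ^+ 2 = normc a ^+ 2 * L2norm f ^+ 2.
Proof.
rewrite sqr_L2norm L2innerZl L2innerZr mulrA Re_mul_conj L2innerff.
by rewrite !ReImE/=; ring.
Qed.

Lemma L2normZ a f : L2norm (a *: f) = normc a * L2norm f.
Proof.
apply/eqP; rewrite -(@eqrXn2 _ 2)// ?L2norm_ge0// ?mulr_ge0 ?normc_ge0 ?L2norm_ge0//.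
by rewrite sqr_L2normZ exprMn.
Qed.

Lemma L2normN f : L2norm (- f) = L2norm f.
Proof. by rewrite /L2norm L2innerNl L2innerNr opprK. Qed.

Lemma sqr_L2normD f g : L2norm (f + g) ^+ 2 =
  L2norm f ^+ 2 + 2 * Re (L2inner f g) + L2norm g ^+ 2.
Proof.
rewrite !sqr_L2norm !L2innerDl !L2innerDr (L2inner_conj f g) !ReImE.
ring.
Qed.

Lemma Cauchy_Schwarz f g : Re (L2inner f g) <= L2norm f * L2norm g.
Proof.
have [/eqP g0|g0] := boolP (L2norm g == 0).
  by rewrite (L2norm0_eq0 g0) L2inner0r L2norm0 mulr0.
have [/eqP f0|f0] := boolP (L2norm f == 0).
  by rewrite (L2norm0_eq0 f0) L2inner0l L2norm0 mul0r.
have gp : 0 < L2norm g by rewrite lt_def g0 L2norm_ge0.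
have fp : 0 < L2norm f by rewrite lt_def f0 L2norm_ge0.
(* The square of [|g| f - |f| g] expands to [2 |f| |g| (|f| |g| - Re <f, g>)]. *)
have := sqr_ge0 (L2norm ((L2norm g)%:C *: f + (- L2norm f)%:C *: g)).
rewrite sqr_L2normD (sqr_L2normZ _ f) (sqr_L2normZ _ g) L2innerZl L2innerZr.
move: (L2inner f g) (L2norm f) (L2norm g) fp gp => w x y xp yp {f0 g0}.
rewrite !normc_sqr !ReImE/= => h.
rewrite -subr_ge0 -(pmulr_rge0 _ (mulr_gt0 xp yp)); nra.
Qed.

Lemma L2normD f g : L2norm (f + g) <= L2norm f + L2norm g.
Proof.
rewrite -ler_sqr ?nnegrE ?addr_ge0 ?L2norm_ge0// sqr_L2normD.
have := Cauchy_Schwarz f g; lra.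
Qed.

Lemma L2normBC f g : L2norm (f - g) = L2norm (g - f).
Proof. by rewrite -L2normN opprB. Qed.

End inner.

(** * Completeness of the sines *)

Section real_analysis.
Context {R : realType}.
Local Notation leb := (@lebesgue_measure R).

Lemma bernoulli_ineq (x : R) n : -1 <= x -> 1 + n%:R * x <= (1 + x) ^+ n.
Proof.
move=> x1; elim: n => [|n IH]; first by rewrite mul0r addr0 expr0.
rewrite exprS; apply: le_trans (ler_wpM2l _ IH); last by lra.
rewrite -natr1; have := ler0n R n; have := sqr_ge0 x; nra.
Qed.

Definition step_poly (n : nat) (s : R) := (1 - s ^+ n) ^+ (2 ^ n).

Lemma step_poly_itv n s : 0 <= s <= 1 -> 0 <= step_poly n s <= 1.
Proof.
move=> /andP[s0 s1]; have h0 := exprn_ge0 n s0.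
have h1 := exprn_ile1 n s0 s1.
by rewrite exprn_ge0 ?subr_ge0// exprn_ile1 ?subr_ge0// gerBl.
Qed.

(* The polynomials [(1 - s^n)^(2^n)] converge boundedly to the indicator of
   [s < 1/2] on [0, 1] minus the point 1/2 (the functions of the Brosowski-Deutsch
   proof of the Stone-Weierstrass theorem). *)
Lemma cvg_step_poly1 s : 0 <= s -> s < 2^-1 -> step_poly n s @[n --> \oo] --> (1 : R).
Proof.
move=> s0 s1; apply: (@squeeze_cvgr _ _ _ _ (fun n => 1 - (2 * s) ^+ n) (cst 1)).
- near=> n; rewrite -/(step_poly n s).
  have /andP[_ ->] : 0 <= step_poly n s <= 1 by apply: step_poly_itv; lra.
  rewrite andbT exprMn.
  have h1 : s ^+ n <= 1 by apply: exprn_ile1 => //; lra.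
  (* Bernoulli gives [(1 - s^n)^(2^n) >= 1 - 2^n s^n = 1 - (2 s)^n], and [2 s < 1]. *)
  have := @bernoulli_ineq (- s ^+ n) (2 ^ n) _; rewrite natrX mulrN => -> //.
  by rewrite lerN2.
- rewrite -[X in _ --> X]subr0; apply: cvgB; first exact: cvg_cst.
  by apply: cvg_expr; rewrite ger0_norm; lra.
- exact: cvg_cst.
Unshelve. all: by end_near. Qed.

Lemma cvg_step_poly0 s : 2^-1 < s -> s <= 1 -> step_poly n s @[n --> \oo] --> (0 : R).
Proof.
move=> s0 s1; apply: (@squeeze_cvgr _ _ _ _ (cst 0) (fun n => (2 * s)^-1 ^+ n)).
- near=> n; rewrite -/(step_poly n s).
  have /andP[-> _] : 0 <= step_poly n s <= 1 by apply: step_poly_itv; lra.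
  have sp : 0 < s by lra.
  have h1 : s ^+ n <= 1 by apply: exprn_ile1 => //; lra.
  have h0 : 0 < s ^+ n by rewrite exprn_gt0.
  rewrite /= exprVn -[leRHS]mul1r ler_pdivlMr ?exprn_gt0//; last lra.
  (* Bernoulli in the other direction: [(2 s)^n <= (1 + s^n)^(2^n)], and [(1 - s^n) (1 + s^n) <= 1],
     so [step_poly n s] is at most [(2 s)^-n]. *)
  have h : (2 * s) ^+ n <= (1 + s ^+ n) ^+ (2 ^ n).
    apply: le_trans (bernoulli_ineq _ _); last lra.
    by rewrite natrX exprMn; lra.
  apply: (le_trans (ler_wpM2l _ h)).
    by rewrite exprn_ge0// subr_ge0.
  rewrite -exprMn; apply: exprn_ile1; nra.
- exact: cvg_cst.
- apply: cvg_expr; rewrite ger0_norm ?invr_ge0; last lra.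
  by rewrite invf_lt1; lra.
Unshelve. all: by end_near. Qed.

Lemma horner_bounded (q : {poly R}) : exists M : R, forall y, `|y| <= 1 -> `|q.[y]| <= M.
Proof.
elim/poly_ind: q => [|q c [M hM]].
  by exists 0 => y _; rewrite horner0 normr0.
exists (M + `|c|) => y y1; rewrite hornerMXaddC.
apply: (le_trans (ler_normD _ _)); rewrite lerD2r normrM.
apply: le_trans (hM _ y1); exact: ler_piMr.
Qed.

Lemma integrable_mul_bounded d (T : measurableType d)
    (mu : {measure set T -> \bar R}) (D : set T) (f h : T -> R) (M : R) :
  measurable D -> mu.-integrable D (EFin \o f) -> measurable_fun D h ->
  (forall x, D x -> `|h x| <= M) ->
  mu.-integrable D (EFin \o (fun x => f x * h x)).
Proof.
move=> mD fi mh hM.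
apply: le_integrable (integrableZl mD M fi) => //.
  apply/measurable_EFinP; apply: measurable_funM => //.
  by apply/measurable_EFinP; exact: measurable_int fi.
move=> x Dx /=; rewrite lee_fin normrM mulrC [leRHS]normrM ler_wpM2r//.
by apply: le_trans (ler_norm _); exact: hM.
Qed.

Lemma continuous_sinM (a : R) : continuous (fun x : R => sin (a * x)).
Proof.
move=> x; apply: (continuous_comp (f := fun y : R => a * y)).
  exact: mulrl_continuous.
exact: continuous_sin.
Qed.

Lemma continuous_cosM (a : R) : continuous (fun x : R => cos (a * x)).
Proof.
move=> x; apply: (continuous_comp (f := fun y : R => a * y)).
  exact: mulrl_continuous.
exact: continuous_cos.
Qed.

Lemma sin_nat_pi n : sin (n%:R * pi) = 0 :> R.
Proof.
elim: n => [|n IH]; first by rewrite mul0r sin0.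
by rewrite -natr1 mulrDl mul1r sinDpi IH oppr0.
Qed.

Lemma measurable_horner (q : {poly R}) : measurable_fun [set: R] (fun x => q.[x]).
Proof.
elim/poly_ind: q => [|q c IH].
  by under eq_fun do rewrite horner0; exact: measurable_cst.
under eq_fun do rewrite hornerMXaddC.
by apply: measurable_funD => //; exact: measurable_funM.
Qed.

Section sine_complete.
Variable G : R -> R.
Hypothesis iG : leb.-integrable setT (EFin \o G).
Hypothesis G0 : forall x, ~ (0 < x < 1) -> G x = 0.
Hypothesis Gsin : forall m, \int[leb]_x (G x * sin (m%:R * pi * x)) = 0.

Let mh (a : R) (q : {poly R}) :
  measurable_fun [set: R] (fun x => sin (a * x) * q.[cos (pi * x)]).
Proof.
apply: measurable_funM.
  by apply: continuous_measurable_fun; exact: continuous_sinM.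
apply: (measurableT_comp (measurable_horner q)).
by apply: continuous_measurable_fun; exact: continuous_cosM.
Qed.

Let ih (a : R) (q : {poly R}) :
  leb.-integrable setT (EFin \o (fun x => G x * (sin (a * x) * q.[cos (pi * x)]))).
Proof.
have [M hM] := horner_bounded q.
apply: (integrable_mul_bounded (M := M) measurableT iG (mh a q)) => x _.
rewrite normrM; apply: le_trans (hM (cos (pi * x)) (cos_max _)).
by apply: ler_piMl => //; exact: sin_max.
Qed.

(** Multiplication by [cos (pi x)] turns the frequency [m + 1] into the half sum of [m + 2] and [m],
    whence an induction on [q] for all frequencies at once; frequency 0 is trivial. *)
Let Gpoly (q : {poly R}) m :
  \int[leb]_x (G x * (sin (m%:R * pi * x) * q.[cos (pi * x)])) = 0.
Proof.
elim/poly_ind: q m => [|q c IH] m.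
  under eq_Rintegral do rewrite horner0 !mulr0.
  by rewrite Rintegral_cst// mul0r.
case: m => [|m].
  under eq_Rintegral do rewrite !mul0r sin0 mul0r mulr0.
  by rewrite Rintegral_cst// mul0r.
pose F j x := G x * (sin (j%:R * pi * x) * q.[cos (pi * x)]).
pose K x := G x * (sin (m.+1%:R * pi * x) * (1%:P : {poly R}).[cos (pi * x)]).
transitivity (\int[leb]_x (1 * (2^-1 * F m.+2 x + 2^-1 * F m x) + c * K x)).
  apply: eq_Rintegral => x _; rewrite /F /K hornerMXaddC hornerC mulr1.
  have e1 : m.+1%:R = m%:R + 1 :> R by rewrite natr1.
  have e2 : m.+2%:R = m.+1%:R + 1 :> R by rewrite natr1.
  have sD : sin (m.+2%:R * pi * x) =
      sin (m.+1%:R * pi * x) * cos (pi * x) + cos (m.+1%:R * pi * x) * sin (pi * x).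
    by rewrite e2 2!mulrDl mul1r sinD.
  have sB : sin (m%:R * pi * x) =
      sin (m.+1%:R * pi * x) * cos (pi * x) - cos (m.+1%:R * pi * x) * sin (pi * x).
    by rewrite e1 2!mulrDl mul1r -sinB addrK.
  rewrite sD sB; set a := sin (m.+1%:R * _ * _); set b := cos (m.+1%:R * _ * _).
  by move: a b (cos (pi * x)) (sin (pi * x)) => a b y z; field.
rewrite Rintegral_lin//; last exact: ih.
  rewrite Rintegral_lin//; [|exact: ih..].
  rewrite !IH (_ : \int[leb]_x K x = 0) ?mulr0 ?addr0 ?mulr0//.
  rewrite -[RHS](Gsin m.+1); apply: eq_Rintegral => x _.
  by rewrite /K hornerC mulr1.
by apply: integrable_lin => //; exact: ih.
Qed.

(** The weight [sin (pi x)] makes every polynomial in [cos (pi x)] an admissible test function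
    ([Gpoly] with [m = 1]); being positive on (0, 1), it can be divided out at the end. *)
Let G1 x := G x * sin (pi * x).

Let iG1 : leb.-integrable setT (EFin \o G1).
Proof.
apply: (integrable_mul_bounded (M := 1) measurableT iG).
  by apply: continuous_measurable_fun; exact: continuous_sinM.
by move=> x _; exact: sin_max.
Qed.

Let G1_int0 (c : R) : 0 < c < 1 -> \int[leb]_(x in `]-oo, c]) G1 x = 0.
Proof.
move=> /andP[c0 c1].
(* An affine function of [cos (pi x)] with values in [0, 1], increasing in [x] on [0, 1] and equal
   to 1/2 at [c]: [step_poly n (s x)] then tends to the indicator of [x < c]. *)
pose s x : R := 2^-1 - (cos (pi * x) - cos (pi * c)) / 4.
pose sq : {poly R} := 2^-1%:P - (4^-1%:P * ('X - (cos (pi * c))%:P)).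
have sE x : sq.[cos (pi * x)] = s x.
  by rewrite /sq !hornerE /s; field.
pose q n : {poly R} := (1 - sq ^+ n) ^+ (2 ^ n).
have qE n x : (q n).[cos (pi * x)] = step_poly n (s x).
  by rewrite /q horner_exp hornerD hornerN horner_exp sE hornerC.
have s01 x : 0 <= s x <= 1.
  rewrite /s; have := cos_geN1 (pi * x); have := cos_geN1 (pi * c).
  have := cos_le1 (pi * x); have := cos_le1 (pi * c); lra.
have ltcos (x y : R) : 0 <= x <= 1 -> 0 <= y <= 1 -> x < y -> cos (pi * y) < cos (pi * x).
  move=> /andP[x0 x1] /andP[y0 y1] xy; rewrite ltr_cos ?in_itv/=.
  - by rewrite ltr_pM2l ?pi_gt0.
  - by rewrite mulr_ge0 ?pi_ge0// ler_piMr ?pi_ge0.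
  - by rewrite mulr_ge0 ?pi_ge0// ler_piMr ?pi_ge0.
pose f n x := (G1 x * step_poly n (s x))%:E.
pose g (x : R) := (G1 x * (x <= c)%R%:R)%:E.
have mstep n : measurable_fun [set: R] (fun x => step_poly n (s x)).
  under eq_fun do rewrite -qE.
  apply: (measurableT_comp (measurable_horner (q n))).
  by apply: continuous_measurable_fun; exact: continuous_cosM.
have mG1 : measurable_fun [set: R] G1.
  by apply/measurable_EFinP; exact: measurable_int iG1.
have mf n : measurable_fun [set: R] (f n).
  by apply/measurable_EFinP; apply: measurable_funM.
have mind : measurable_fun [set: R] (fun x : R => ((x <= c)%R)%:R : R).
  rewrite (_ : (fun x => _) = \1_(`]-oo, c]%classic)); first exact: measurable_indic.
  by apply/funext => x; rewrite indicE mem_setE in_itv/=.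
have mg : measurable_fun [set: R] g.
  by apply/measurable_EFinP; apply: measurable_funM.
have [] := @dominated_convergence _ _ R leb _ measurableT f g
    (fun x => (`|G1 x|)%:E) mf mg.
(* At [x = c] the values are [(1 - 2^-n)^(2^n)], which do not tend to 1; a single point is
   negligible. *)
- have : leb.-negligible [set c] by apply/negligibleP => //; exact: lebesgue_measure_set1.
  apply: negligibleS => x /= nx; apply: contrapT => /eqP xc; apply: nx => _.
  rewrite /f /g; apply: cvg_EFin; first by near=> n.
  have [x01|x01] := boolP (0 < x < 1); last first.
    rewrite /G1 G0 ?mul0r; last exact/negP.
    by under eq_fun do rewrite mul0r; exact: cvg_cst.
  apply: cvgM; first exact: cvg_cst.
  case/andP: x01 => x0 x1; case/andP: (s01 x) => s0 s1.
  case: (ltgtP x c) xc => // xc _ /=.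
    apply: cvg_step_poly1 => //.
    have := ltcos _ _ _ _ xc; rewrite /s; lra.
  apply: cvg_step_poly0 => //.
  have := ltcos _ _ _ _ xc; rewrite /s; lra.
- by apply: integrable_abse iG1.
- apply/nearW => x n _ /=.
  rewrite lee_fin normrM ler_piMr//.
  by have /andP[h0 h1] := step_poly_itv n (s01 x); rewrite ger0_norm.
move=> _ _; rewrite [X in X @ \oo --> _](_ : _ = cst 0%E); last first.
  apply/funext => n /=; transitivity (\int[leb]_x (G1 x * step_poly n (s x)))%:E.
    rewrite /Rintegral fineK//; apply: integrable_fin_num => //.
    have [M hM] := horner_bounded (q n).
    apply: (integrable_mul_bounded (M := M) measurableT iG1 (mstep n)) => x _.
    by rewrite -qE; apply: hM; exact: cos_max.
  congr EFin; rewrite -[RHS](Gpoly (q n) 1).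
  by apply: eq_Rintegral => x _; rewrite /G1 qE mul1r mulrA.
move=> /cvg_lim => /(_ (@ereal_hausdorff R)); rewrite lim_cst//.
move=> h; rewrite Rintegral_mkcond /Rintegral -[RHS]/(fine (0%E : \bar R)) h.
congr fine; apply: eq_integral => x _; rewrite /g patchE mem_setE in_itv/=.
by case: ifP => _; rewrite ?mulr1 ?mulr0.
Unshelve. all: by end_near. Qed.

(** The primitive of [G1] vanishes on (0, 1), and by Lebesgue differentiation its derivative is [G1]
    almost everywhere; [sin (pi x) > 0] then gives [G = 0]. *)
Lemma sine_complete : {ae leb, forall x, G x = 0}.
Proof.
have iGs (A : set R) : measurable A -> leb.-integrable A (EFin \o G1).
  by move=> mA; apply: integrableS iG1.
have lG : locally_integrable setT G1.
  have := @integrable_locally R G1 setT measurableT iG1.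
  by rewrite patch_setT.
apply: ae_imp (FTC1Ny (fun y => iGs _ (measurable_itv _)) lG) => x [_].
have [x01|x01] := boolP (0 < x < 1); last by rewrite G0//; exact/negP.
have -> : (fun x => \int[leb]_(t in `]-oo, x]) G1 t)^`()%classic x = 0.
  rewrite derive1E (@near_eq_derive _ _ _ _ (cst 0)) ?derive_cst//.
  case/andP: x01 => x0 x1.
  near=> y; apply: G1_int0; apply/andP; split.
    by near: y; exact: lt_nbhsr.
  by near: y; exact: lt_nbhsl.
move=> /esym/eqP; rewrite mulf_eq0 => /orP[/eqP//|/eqP].
case/andP: x01 => x0 x1.
have : 0 < sin (pi * x).
  by apply: sin_gt0_pi; rewrite mulr_gt0 ?pi_gt0// gtr_pMr ?pi_gt0.
by move=> /[swap] ->; rewrite ltxx.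
Unshelve. all: by end_near. Qed.

End sine_complete.
End real_analysis.

Section mu01_theory.
Context {R : realType}.
Local Notation leb := (@lebesgue_measure R).
Local Notation mu := (@mu01 R).
Local Notation H := (L2C R).
Implicit Types f g : H.

Lemma integral_mu01 (f : R -> \bar R) : measurable_fun setT f ->
  (\int[mu]_x f x = \int[leb]_x (f \_ `]0%R, 1%R[%classic) x)%E.
Proof.
move=> mf; rewrite -integral_mkcond [RHS](eq_measure_integral mu); last first.
  move=> A mA A01; rewrite /mu01 /mrestr /= /mrestr.
  by rewrite setIidl//; exact: A01.
rewrite [RHS]integral_mkcond; apply: ae_eq_integral => //.
  by apply/(measurable_restrictT _ _).1 => //; exact: measurable_funTS.
exists (~` `]0%R, 1%R[%classic); split.
- exact: measurableC.
- by rewrite /mu01 /mrestr /= /mrestr setICl measure0.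
- move=> x /= h x01; apply: h => _; rewrite patchE.
  by rewrite mem_set.
Qed.

Lemma integrable_mu01 (f : R -> R) : mu.-integrable setT (EFin \o f) ->
  leb.-integrable setT (EFin \o (f \_ `]0%R, 1%R[%classic)).
Proof.
move=> /integrableP[mf fi].
have mg : measurable_fun setT (EFin \o (f \_ `]0%R, 1%R[%classic)).
  apply/measurable_EFinP; apply/(measurable_restrictT _ _).1 => //.
  by apply: measurable_funTS; exact/measurable_EFinP.
apply/integrableP; split => //.
move: fi; rewrite integral_mu01; last exact: measurableT_comp.
congr (_ < _)%E; apply: eq_integral => x _.
by rewrite /= !patchE; case: ifP => //; rewrite normr0.
Qed.

Lemma Rintegral_mu01 (f : R -> R) : measurable_fun setT f ->
  \int[mu]_x f x = \int[leb]_x (f \_ `]0%R, 1%R[%classic) x.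
Proof.
move=> mf; congr fine; rewrite integral_mu01; last exact/measurable_EFinP.
by apply: eq_integral => x _; rewrite !patchE; case: ifP.
Qed.

Lemma sine_complete_mu01 (f : R -> R) : mu.-integrable setT (EFin \o f) ->
  (forall m, \int[mu]_x (f x * sin (m%:R * pi * x)) = 0) ->
  {ae mu, forall x, f x = 0}.
Proof.
move=> fi fs.
have mf : measurable_fun setT f by apply/measurable_EFinP; exact: measurable_int fi.
have [||N [mN N0 Nsub]] := sine_complete (integrable_mu01 fi).
- move=> x x01; rewrite patchE; case: ifPn => //.
  by rewrite mem_setE in_itv/= => /x01.
- move=> m; rewrite -[RHS](fs m) Rintegral_mu01; last first.
    apply: measurable_funM => //.
    by apply: continuous_measurable_fun; exact: continuous_sinM.
  apply: eq_Rintegral => x _; rewrite !patchE; case: ifP => //.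
  by rewrite mul0r.
exists (N `|` ~` `]0%R, 1%R[%classic); split.
- by apply: measurableU => //; exact: measurableC.
- rewrite /mu01 /mrestr /= /mrestr; rewrite setIUl /= setICl setU0.
  apply: (@subset_measure0 _ _ _ _ _ N) => //.
  by apply: measurableI => //; exact: measurable_unit_itv.
- move=> x /= fx; case: (boolP (x \in `]0, 1[)) => x01; [left|by right; apply/negP].
  by apply: Nsub => /=; rewrite patchE mem_setE x01.
Qed.

Lemma mu01_setT_fin : mu [set: R] \is a fin_num.
Proof.
rewrite /mu01 /mrestr /= /mrestr setTI /unit_itv lebesgue_measure_itv/=.
by rewrite lte01 -EFinB.
Qed.

Lemma L2inner_sine_rep (f : @L2rep R) m :
  L2inner (L2class f) (sine_basis m) =
  (Num.sqrt 2 * \int[mu]_x (Re (L2val f x) * sin (m%:R * pi * x))) +i*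
  (Num.sqrt 2 * \int[mu]_x (Im (L2val f x) * sin (m%:R * pi * x))).
Proof.
have hs (h : R -> R) : h \in Lfun mu 2%:E ->
    mu.-integrable setT (EFin \o (fun x => h x * sin (m%:R * pi * x))).
  move=> h2; apply: (integrable_mul_bounded (M := 1)) => //.
  - apply/Lfun1_integrable; apply: Lfun_subset12 h2; exact: mu01_setT_fin.
  - by apply: continuous_measurable_fun; exact: continuous_sinM.
  - by move=> x _; exact: sin_max.
have [fr fi] := L2val_Lfun f.
rewrite /sine_basis L2inner_class /=; congr Complex.
- rewrite -RintegralZl//; last exact: hs.
  by apply: eq_Rintegral => x _; rewrite !ReImE/=; ring.
- rewrite -RintegralZl//; last exact: hs.
  by apply: eq_Rintegral => x _; rewrite !ReImE/=; ring.
Qed.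

(** The sines are real, so the coordinates of [f] split into those of its real and imaginary parts.
    Real completeness applies to each, L^2 being contained in L^1 on an interval of finite
    length. *)
Lemma L2_sine_complete f :
  (forall m, (0 < m)%N -> L2inner f (sine_basis m) = 0) -> f = 0.
Proof.
move=> f0; apply: L2norm0_eq0; rewrite -(L2classK f).
have s2 : Num.sqrt 2 != 0 :> R by rewrite sqrtr_eq0 -ltNge.
have hl (h : R -> R) : h \in Lfun mu 2%:E -> mu.-integrable setT (EFin \o h).
  by move=> h2; apply/Lfun1_integrable; apply: Lfun_subset12 h2; exact: mu01_setT_fin.
have hz (h : R -> R) : h \in Lfun mu 2%:E ->
    (forall m, (0 < m)%N -> Num.sqrt 2 * \int[mu]_x (h x * sin (m%:R * pi * x)) = 0) ->
    {ae mu, forall x, h x = 0}.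
  move=> h2 hm; apply: sine_complete_mu01; first exact: hl.
  case=> [|m].
    under eq_Rintegral do rewrite !mul0r sin0 mulr0.
    by rewrite Rintegral_cst// mul0r.
  by have /eqP := hm m.+1 isT; rewrite mulf_eq0 (negbTE s2)/= => /eqP.
have [fr fi] := L2val_Lfun (repr f).
have zr : {ae mu, forall x, Re (L2val (repr f) x) = 0}.
  apply: hz => // m m0; have := f0 m m0.
  by rewrite -{1}(L2classK f) L2inner_sine_rep => -[].
have zi : {ae mu, forall x, Im (L2val (repr f) x) = 0}.
  apply: hz => // m m0; have := f0 m m0.
  by rewrite -{1}(L2classK f) L2inner_sine_rep => -[].
rewrite /L2norm L2inner_class.
rewrite (_ : cintegral _ _ _ = cintegral mu setT (cst 0)); last first.
  apply: ae_eq_cintegral => //.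
  - exact: cintegrable_inner.
  - by split; exact: integrable0.
  - apply: ae_imp2 zr zi => x a b _; apply: complex_ext; rewrite !ReImE/= a b; ring.
by rewrite /= Rintegral_cst// mul0r sqrtr0.
Qed.

Lemma Rintegral_cosM (a : R) : sin a = 0 ->
  \int[mu]_x cos (a * x) = (a == 0)%:R.
Proof.
move=> sa; have mc : measurable_fun setT (fun x : R => cos (a * x)).
  by apply: continuous_measurable_fun; exact: continuous_cosM.
have [->|a0] := eqVneq.
  under eq_Rintegral do rewrite mul0r cos0.
  rewrite Rintegral_cst// mul1r /mu01 /mrestr /= /mrestr setTI /unit_itv lebesgue_measure_itv/=.
  by rewrite lte01 -EFinB/= subr0.
rewrite Rintegral_mu01// -Rintegral_mkcond /Rintegral.
rewrite -(integral_itv_bndoo true false); last first.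
  by apply/measurable_EFinP; exact: measurable_funTS.
have dF (x : R) : is_derive x 1 (fun x => a^-1 * sin (a * x)) (cos (a * x)).
  have h : is_derive x 1 (fun y : R => a * y) a.
    by apply: is_derive_eq; rewrite [LHS]mulr1.
  have h2 := @is_derive1_comp R sin (fun y => a * y) x _ _ (is_derive_sin _) h.
  apply: is_derive_eq.
  by rewrite /GRing.scale/= mulrCA mulVf// mulr1.
have cF : continuous (fun x => a^-1 * sin (a * x)).
  by move=> x; apply: cvgM; [exact: cvg_cst|exact: continuous_sinM].
rewrite (@continuous_FTC2 _ _ (fun x => a^-1 * sin (a * x)))//=.
- by rewrite mulr1 mulr0 sa sin0 mulr0 subrr.
- by apply: continuous_subspaceT; exact: continuous_cosM.
- split.
  + by move=> x _; exact: ex_derive.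
  + by apply: cvg_at_right_filter; exact: cF.
  + by apply: cvg_at_left_filter; exact: cF.
- by move=> x _; rewrite derive1E; exact: derive_val.
Qed.

Lemma sine_orthonormal m n : (0 < m)%N -> (0 < n)%N ->
  L2inner (@sine_basis R m) (sine_basis n) = (m == n)%:R.
Proof.
move=> m0 n0; rewrite [sine_basis m]/sine_basis L2inner_sine_rep /=.
have cint (a : R) : mu.-integrable setT (EFin \o (fun x : R => cos (a * x))).
  rewrite (_ : (fun x : R => cos (a * x)) = (fun x => 1 * cos (a * x))); last first.
    by apply/funext => x; rewrite mul1r.
  apply: (integrable_mul_bounded (M := 1)) => //.
  - apply/integrableP; split; first exact: measurable_cst.
    under eq_integral do rewrite /= normr1.
    by rewrite integral_cst// mul1e -ge0_fin_numE// mu01_setT_fin.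
  - by apply: continuous_measurable_fun; exact: continuous_cosM.
  - by move=> x _; exact: cos_max.
apply: complex_ext => /=; last first.
  under eq_Rintegral do rewrite mul0r.
  by rewrite Rintegral_cst// mul0r mulr0; case: (m == n).
have s2 : Num.sqrt 2 * Num.sqrt 2 = 2 :> R by rewrite -expr2 sqr_sqrtr.
(* Product to sum: [2 sin a sin b = cos (a - b) - cos (a + b)]. One normalising factor [sqrt 2]
   stays outside the integral, which leaves the coefficients [1 / sqrt 2]. *)
have := @Rintegral_lin _ _ R mu setT (fun x => cos ((m%:R * pi - n%:R * pi) * x))
  (fun x => cos ((m%:R * pi + n%:R * pi) * x)) ((Num.sqrt 2)^-1) (- (Num.sqrt 2)^-1)
  measurableT (cint _) (cint _).
rewrite !Rintegral_cosM; first last.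
- by rewrite sinB !sin_nat_pi mul0r mulr0 subrr.
- by rewrite sinD !sin_nat_pi mul0r mulr0 addr0.
have -> : m%:R * pi + n%:R * pi == 0 :> R = false.
  apply/negbTE/lt0r_neq0/ltr_pwDl; last by rewrite mulr_ge0// pi_ge0.
  by rewrite mulr_gt0 ?pi_gt0// ltr0n.
have -> : m%:R * pi - n%:R * pi == 0 :> R = (m == n).
  rewrite subr_eq0; have [->|mn] := eqVneq m n; first by rewrite eqxx.
  apply/negbTE; apply: contra mn => /eqP/(mulIf (lt0r_neq0 (pi_gt0 R)))/eqP.
  by rewrite eqr_nat.
rewrite mulr0 addr0 => h.
transitivity (Num.sqrt 2 * ((Num.sqrt 2)^-1 * (m == n)%:R : R)); last first.
  by rewrite mulVKf ?sqrtr_eq0 -?ltNge//; case: (m == n).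
rewrite -h; congr (_ * _); apply: eq_Rintegral => x _.
rewrite mulrBl mulrDl cosB cosD.
apply: (@mulfI _ (Num.sqrt 2)); first by rewrite sqrtr_eq0 -ltNge.
have sn0 : Num.sqrt 2 != 0 :> R by rewrite sqrtr_eq0 -ltNge.
move: (sin _) (sin _) (cos _) (cos _) => a b a' b'.
rewrite mulrDr mulNr mulrN !(mulrA _ (_^-1)) mulfV// !mul1r -mulrA (mulrA (Num.sqrt 2)) s2.
ring.
Qed.

End mu01_theory.

(** * The semigroup and Parseval's identity *)

Section Cexp_theory.
Context {R : realType}.

Lemma normcM (z w : R[i]) : normc (z * w) = normc z * normc w.
Proof. exact: ComplexField.Normc.normcM. Qed.

Lemma CexpD (z w : R[i]) : Cexp (z + w) = Cexp z * Cexp w.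
Proof.
case: z w => [a b] [c d]; rewrite /Cexp/= expRD cosD sinD.
by apply: complex_ext => /=; ring.
Qed.

Lemma Cexp0 : Cexp (0 : R[i]) = 1.
Proof. by rewrite /Cexp /= expR0 cos0 sin0 mulr1 mulr0. Qed.

Lemma normc_Cexp (z : R[i]) : normc (Cexp z) = expR (Re z).
Proof.
apply/eqP; rewrite -(@eqrXn2 _ 2) ?normc_ge0 ?expR_ge0// normc_sqr /=.
rewrite !exprMn -mulrDr [X in _ * X]addrC.
by rewrite [X in _ * X]addrC cos2Dsin2 mulr1.
Qed.

End Cexp_theory.

Section semigroup.
Context {R : realType}.
Local Notation H := (L2C R).
Local Notation e := (@sine_basis R).
Implicit Types f g h : H.

Lemma cvgL2_inner_eq (v : nat -> H) f h c N : cvgL2 v f ->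
  (forall n, (N <= n)%N -> L2inner (v n) h = c) -> L2inner f h = c.
Proof.
move=> vf vc.
suff hz (g : H) (a : R) : (forall n, (N <= n)%N -> Re (L2inner (v n) g) = a) ->
    Re (L2inner f g) = a.
  apply: complex_ext; first by apply: hz => n /vc ->.
  (* Real parts suffice: the factor [conj i] that turns [Im] into [Re] moves into the second
     argument of the inner product. *)
  have hI z : Im z = Re (('i : R[i])^* * z) :> R by rewrite !ReImE/=; ring.
  by rewrite !hI -L2innerZr; apply: hz => n /vc nc; rewrite L2innerZr nc.
move=> va; apply/eqP; rewrite -subr_eq0 -normr_le0.
have h0 : (fun n => L2norm (v n - f) * L2norm g) @ \oo --> (0 : R).
  by rewrite -[X in _ --> X](mul0r (L2norm g)); apply: cvgM => //; exact: cvg_cst.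

apply: (cvgr_to_ge h0); near=> n.
have <- : Re (L2inner (v n) g) = a by apply: va; near: n; exact: nbhs_infty_ge.
have hre x y : Re x - Re y = Re (x - y) :> R by rewrite cReD cReN.
rewrite hre -L2innerBl L2normBC ler_norml Cauchy_Schwarz andbT lerNl -cReN -L2innerNl opprB.
by rewrite L2normBC Cauchy_Schwarz.
Unshelve. all: by end_near. Qed.

Lemma L2inner_sine_sum (c : nat -> R[i]) n k : (0 < k)%N -> (k <= n)%N ->
  L2inner (\sum_(1 <= m < n.+1) c m *: e m) (e k) = c k.
Proof.
move=> k0 kn; rewrite L2inner_suml (bigD1_seq k) ?iota_uniq//=; last first.
  by rewrite mem_index_iota k0 ltnS.
rewrite L2innerZl sine_orthonormal// eqxx mulr1.
rewrite big_seq_cond big1 ?addr0// => m; rewrite mem_index_iota => /andP[/andP[m0 _] mk].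
by rewrite L2innerZl sine_orthonormal// (negbTE mk) mulr0.
Qed.

Definition sine_sum n f : H := \sum_(1 <= m < n.+1) L2inner f (e m) *: e m.

Lemma sqr_L2normB_sine_sum n f : L2norm (sine_sum n f - f) ^+ 2 =
  L2norm f ^+ 2 - \sum_(1 <= m < n.+1) normc (L2inner f (e m)) ^+ 2.
Proof.
set s := \sum_(1 <= m < n.+1) _.
have fs : L2inner f (sine_sum n f) = s%:C.
  rewrite L2inner_sumr rmorph_sum; apply: eq_bigr => m _ /=.
  by rewrite L2innerZr mulrC Re_mul_conj.
have ss : L2inner (sine_sum n f) (sine_sum n f) = s%:C.
  rewrite [X in L2inner _ X]/sine_sum L2inner_sumr rmorph_sum big_seq [RHS]big_seq.
  apply: eq_bigr => m; rewrite mem_index_iota => /andP[m0 mn].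
  by rewrite L2innerZr L2inner_sine_sum// mulrC Re_mul_conj.
rewrite L2normBC sqr_L2normD L2innerNr L2normN !sqr_L2norm fs ss /=; ring.
Qed.

Variables (alpha : R) (S : R -> H -> H).
Hypothesis S_semi : is_semigroup alpha S.

(** By orthonormality the [k]-th coordinate of the partial sums is constant from [n = k] on, so the
    limit inherits it. *)
Lemma semigroup_coord t f k : 0 <= t -> (0 < k)%N ->
  L2inner (S t f) (e k) =
  Cexp (- (t%:C * Lambda_eigenvalue alpha k)) * L2inner f (e k).
Proof.
move=> t0 k0; apply: (cvgL2_inner_eq (N := k) (S_semi f t0)) => n kn.
exact: L2inner_sine_sum.
Qed.

Lemma L2_sine_ext f g :
  (forall m, (0 < m)%N -> L2inner f (e m) = L2inner g (e m)) -> f = g.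
Proof.
move=> fg; apply/eqP; rewrite -subr_eq0; apply/eqP; apply: L2_sine_complete => m m0.
by rewrite L2innerBl fg// subrr.
Qed.

Lemma semigroup0 f : S 0 f = f.
Proof.
apply: L2_sine_ext => m m0; rewrite semigroup_coord//.
by rewrite mul0r oppr0 Cexp0 mul1r.
Qed.

(** The expansion defining [S], taken at time 0, says that the sine sums of [f] converge to [S 0 f],
    which is [f]. The convergence of the sine series is thus read off from [S], and Pythagoras turns
    it into a statement on norms. *)
Lemma parseval f : (fun n => \sum_(1 <= m < n.+1) normc (L2inner f (e m)) ^+ 2)
  @ \oo --> L2norm f ^+ 2.
Proof.
have : cvgL2 (sine_sum^~ f) f.
  have := S_semi f (lexx 0); rewrite semigroup0 /cvgL2 /sine_sum.
  by under eq_fun do under eq_bigr do rewrite mul0r oppr0 Cexp0 mul1r.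
move=> h; have {}h := cvgM h h.
have {h} : (fun n => L2norm f ^+ 2 - L2norm (sine_sum n f - f) ^+ 2) @ \oo --> L2norm f ^+ 2.
  rewrite -[X in _ --> X]subr0 -[X in _ - X](mulr0 0).
  by apply: cvgB; [exact: cvg_cst|exact: h].
by under eq_fun do rewrite sqr_L2normB_sine_sum opprB addrC subrK.
Qed.

Arguments parseval : clear implicits.

Lemma L2norm_le_coord (K : R) f g : 0 <= K ->
  (forall m, (0 < m)%N -> normc (L2inner f (e m)) <= K * normc (L2inner g (e m))) ->
  L2norm f <= K * L2norm g.
Proof.
move=> K0 h; rewrite -ler_sqr ?nnegrE ?mulr_ge0 ?L2norm_ge0// exprMn.
have hg : (fun n => K ^+ 2 * \sum_(1 <= m < n.+1) normc (L2inner g (e m)) ^+ 2)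
    @ \oo --> K ^+ 2 * L2norm g ^+ 2.
  by apply: cvgM; [exact: cvg_cst|exact: parseval].
apply: (ler_cvg_to (parseval f) hg); apply: nearW => n.
rewrite mulr_sumr big_seq [leRHS]big_seq; apply: ler_sum => m.
rewrite mem_index_iota => /andP[m0 _].
by rewrite -exprMn ler_sqr ?nnegrE ?mulr_ge0 ?normc_ge0//; exact: h.
Qed.

Lemma semigroup_contr t f : 0 <= t -> L2norm (S t f) <= expR (- (alpha * t)) * L2norm f.
Proof.
move=> t0; apply: L2norm_le_coord; first exact: expR_ge0.
move=> m m0; rewrite semigroup_coord// normcM normc_Cexp.
rewrite (_ : Re _ = - (alpha * t))//.
by rewrite !ReImE/= mul0r subr0 mulrC.
Qed.

Lemma semigroupD t f g : 0 <= t -> S t (f + g) = S t f + S t g.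
Proof.
move=> t0; apply: L2_sine_ext => m m0.
by rewrite semigroup_coord// !L2innerDl !semigroup_coord// mulrDr.
Qed.

Lemma semigroupZ t a f : 0 <= t -> S t (a *: f) = a *: S t f.
Proof.
move=> t0; apply: L2_sine_ext => m m0.
by rewrite semigroup_coord// !L2innerZl !semigroup_coord// mulrCA.
Qed.

Lemma semigroupB t f g : 0 <= t -> S t (f - g) = S t f - S t g.
Proof. by move=> t0; rewrite semigroupD// -scaleN1r semigroupZ// scaleN1r. Qed.

Lemma semigroup_sum (I : Type) (r : seq I) (p : pred I) (F : I -> H) t : 0 <= t ->
  S t (\sum_(i <- r | p i) F i) = \sum_(i <- r | p i) S t (F i).
Proof.
move=> t0; elim/big_ind2 : _ => //.
  by rewrite -(scale0r 0) semigroupZ// !scale0r.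
by move=> ? ? ? ? <- <-; rewrite semigroupD.
Qed.

Lemma semigroup_comp s t f : 0 <= s -> 0 <= t -> S t (S s f) = S (s + t) f.
Proof.
move=> s0 t0; apply: L2_sine_ext => m m0.
rewrite !semigroup_coord ?addr_ge0// mulrA -CexpD; congr (Cexp _ * _).
by rewrite rmorphD/=; ring.
Qed.

(** * Measurability of H-valued maps through their coordinates *)

Section weak_measurability.
Context {d} {T : measurableType d}.
Implicit Types (D : set T) (X Y : T -> H).

(* Used instead of Borel measurability because sums preserve it without any
   appeal to the separability of H; Parseval's identity still makes norms
   measurable. *)
Definition weakly_measurable D X := forall m, (0 < m)%N ->
  measurable_fun D (fun w => Re (L2inner (X w) (e m))) /\
  measurable_fun D (fun w => Im (L2inner (X w) (e m))).

Lemma weakly_measurable_cst D (h : H) : weakly_measurable D (fun=> h).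
Proof. by move=> m _; split; exact: measurable_cst. Qed.

Lemma weakly_measurableD D X Y : weakly_measurable D X -> weakly_measurable D Y ->
  weakly_measurable D (fun w => X w + Y w).
Proof.
move=> mX mY m m0; have [Xr Xi] := mX m m0; have [Yr Yi] := mY m m0.
split.
  apply: eq_measurable_fun (measurable_funD Xr Yr) => w _.
  by rewrite L2innerDl cReD.
apply: eq_measurable_fun (measurable_funD Xi Yi) => w _.
by rewrite L2innerDl cImD.
Qed.

Lemma weakly_measurableZ D (c : T -> R[i]) X :
  measurable_fun D (fun w => Re (c w)) -> measurable_fun D (fun w => Im (c w)) ->
  weakly_measurable D X -> weakly_measurable D (fun w => c w *: X w).
Proof.
move=> cr ci mX m m0; have [Xr Xi] := mX m m0.
split.
  apply: (eq_measurable_fun (fun w => Re (c w) * Re (L2inner (X w) (e m)) -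
      Im (c w) * Im (L2inner (X w) (e m)))) => [w _|].
    by rewrite L2innerZl cReM.
  by apply: measurable_funB; exact: measurable_funM.
apply: (eq_measurable_fun (fun w => Re (c w) * Im (L2inner (X w) (e m)) +
    Im (c w) * Re (L2inner (X w) (e m)))) => [w _|].
  by rewrite L2innerZl cImM.
by apply: measurable_funD; exact: measurable_funM.
Qed.

Lemma weakly_measurableZc D (c : R[i]) X :
  weakly_measurable D X -> weakly_measurable D (fun w => c *: X w).
Proof. by apply: weakly_measurableZ; exact: measurable_cst. Qed.

Lemma weakly_measurableB D X Y : weakly_measurable D X -> weakly_measurable D Y ->
  weakly_measurable D (fun w => X w - Y w).
Proof.
move=> mX mY; rewrite (_ : (fun w => _) = (fun w => X w + (-1) *: Y w)).
  by apply: weakly_measurableD => //; exact: weakly_measurableZc.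
by apply/funext => w; rewrite scaleN1r.
Qed.

Lemma weakly_measurable_semigroup D t X : 0 <= t -> weakly_measurable D X ->
  weakly_measurable D (fun w => S t (X w)).
Proof.
move=> t0 mX m m0.
pose c := Cexp (- (t%:C * Lambda_eigenvalue alpha m)).
have [Xr Xi] := weakly_measurableZc c mX m0.
by split; [apply: eq_measurable_fun Xr|apply: eq_measurable_fun Xi] => w _;
  rewrite semigroup_coord// L2innerZl.
Qed.

Lemma weakly_measurable_norm D X : weakly_measurable D X ->
  measurable_fun D (fun w => L2norm (X w)).
Proof.
move=> mX.
have m2 : measurable_fun D (fun w => L2norm (X w) ^+ 2).
  apply: (measurable_fun_cvg (h := fun n w =>
      \sum_(1 <= m < n.+1) normc (L2inner (X w) (e m)) ^+ 2)) => [n|w _].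
    apply: (eq_measurable_fun (fun w => \sum_(m <- index_iota 1 n.+1) (if (0 < m)%N then
      (Re (L2inner (X w) (e m)) ^+ 2 + Im (L2inner (X w) (e m)) ^+ 2) else 0))) => [w _|].
      rewrite big_seq [RHS]big_seq; apply: eq_bigr => m.
      by rewrite mem_index_iota => /andP[-> _]; rewrite normc_sqr.
    apply: measurable_sum => m; case: (ltnP 0 m) => [m0|_]; last exact: measurable_cst.
    have [Xr Xi] := mX m m0.
    exact: (measurable_funD (measurable_funX 2 Xr) (measurable_funX 2 Xi)).
  exact: parseval.
rewrite (_ : (fun w => _) = @Num.sqrt R \o (fun w => L2norm (X w) ^+ 2)).
  apply: measurableT_comp m2; apply: continuous_measurable_fun.
  exact: sqrt_continuous.
by apply/funext => w /=; rewrite sqrtr_sqr ger0_norm// L2norm_ge0.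
Qed.

Lemma openL2_re_gt (h : H) (c : R) : openL2 [set f | c < Re (L2inner f h)].
Proof.
move=> f; rewrite /mkset => cf; have h1 : 0 < L2norm h + 1.
  by apply: ltr_wpDl => //; exact: L2norm_ge0.
(* Cauchy-Schwarz asks for a radius of order [1 / L2norm h]; the [+ 1] covers [h = 0]. *)
exists ((Re (L2inner f h) - c) / (L2norm h + 1)).
  by apply: divr_gt0 => //; rewrite subr_gt0.
move=> g; rewrite ltr_pdivlMr// L2normBC => gf; rewrite /mkset.
have := Cauchy_Schwarz (f - g) h; rewrite L2innerBl cReD cReN.
have := L2norm_ge0 (f - g); rewrite mulrDr mulr1 in gf.
move: gf; set p := L2norm _ * _; set q := L2norm _; set a := Re _; set b := Re _.
rewrite /a /b; move: (Re _) (Re _) p q => x y p q; lra.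
Qed.

Lemma measurable_re_inner D X (h : H) : measurable D ->
  (forall U, openL2 U -> measurable (D `&` X @^-1` U)) ->
  measurable_fun D (fun w => Re (L2inner (X w) h)).
Proof.
move=> mD XU _.
apply: (measurability _ (@RGenOInfty.measurableE R)) => // _ [_ [c ->] <-].
rewrite (_ : _ @^-1` _ = X @^-1` [set f | c < Re (L2inner f h)]).
  by apply: XU; exact: openL2_re_gt.
by apply/seteqP; split => w /=; rewrite in_itv/= andbT.
Qed.

Lemma open_weakly_measurable D X : measurable D ->
  (forall U, openL2 U -> measurable (D `&` X @^-1` U)) -> weakly_measurable D X.
Proof.
move=> mD XU m m0; split; first exact: measurable_re_inner.
apply: eq_measurable_fun (measurable_re_inner ('i *: e m) mD XU) => w _.
by rewrite L2innerZr !ReImE/=; ring.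
Qed.

End weak_measurability.
End semigroup.

(** * The norm of L^2(Omega; H) *)

Section L2Om.
Context {R : realType} {d : measure_display} {Om : measurableType d}.
Variable P : probability Om R.
Local Notation H := (L2C R).
Local Notation e := (@sine_basis R).
Implicit Types X Y Z : Om -> H.

Lemma L2Om_norm_ge0 X : (0 <= L2Om_norm P X)%E.
Proof. exact: Lnorm_ge0. Qed.

Variables (alpha : R) (S : R -> H -> H).
Hypothesis S_semi : is_semigroup alpha S.

Local Notation wm := (@weakly_measurable R d Om setT).
Local Notation mnorm := (weakly_measurable_norm S_semi).

(** Minkowski in the form that the error recursion consumes: from a pointwise bound holding almost
    surely, with norms that may be infinite. The case [b = 0] yields monotonicity, hence invariance
    under almost sure equality. *)
Lemma L2Om_norm_lin X Y Z (a b : R) : 0 <= a -> 0 <= b -> wm X -> wm Y -> wm Z ->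
  {ae P, forall w, L2norm (Z w) <= a * L2norm (X w) + b * L2norm (Y w)} ->
  (L2Om_norm P Z <= a%:E * L2Om_norm P X + b%:E * L2Om_norm P Y)%E.
Proof.
move=> a0 b0 wX wY wZ h.
have mp (f : Om -> R) : measurable_fun setT f ->
    measurable_fun setT (fun x => `|(EFin \o f) x| `^ 2)%E.
  move=> mf; apply: (measurableT_comp (measurable_poweR 2)).
  by apply: measurableT_comp => //; exact/measurable_EFinP.
have scal (f : Om -> R) (c : R) : 0 <= c -> measurable_fun setT f ->
    ('N[P]_2%:E[EFin \o (fun w => (c * f w)%R)] = c%:E * 'N[P]_2%:E[EFin \o f])%E.
  move=> c0 mf; rewrite unlock /Lnorm.
  rewrite (_ : (\int[P]_x `|(EFin \o (fun w => c * f w)%R) x| `^ 2 =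
      (c `^ 2)%:E * \int[P]_x `|(EFin \o f) x| `^ 2)%E); last first.
    rewrite -ge0_integralZl_EFin//; last 3 first.
    - by move=> x _; exact: poweR_ge0.
    - exact: mp.
    - exact: powR_ge0.
    apply: eq_integral => x _ /=.
    by rewrite normrM (ger0_norm c0) powRM// EFinM.
  rewrite poweRM ?lee_fin ?powR_ge0 ?integral_ge0//; last by move=> ? _; exact: poweR_ge0.
  by rewrite -poweR_EFin -poweRrM mulfV// poweRe1.
have mX := mnorm wX; have mY := mnorm wY; have mZ := mnorm wZ.
have maX : measurable_fun setT (fun w => a * L2norm (X w)) by exact: measurable_funM.
have mbY : measurable_fun setT (fun w => b * L2norm (Y w)) by exact: measurable_funM.
rewrite /L2Om_norm -[X in (_ <= X * _ + _)%E]/(a%:E) -!scal//.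
apply: le_trans (minkowski_EFin _ maX mbY _); last by rewrite ler1n.
rewrite unlock /Lnorm gt0_ler_poweR//.
- by rewrite in_itv/= leey andbT integral_ge0// => x _; exact: poweR_ge0.
- by rewrite in_itv/= leey andbT integral_ge0// => x _; exact: poweR_ge0.
apply: ae_ge0_le_integral => //.
- by move=> x _; exact: poweR_ge0.
- exact: mp.
- by move=> x _; exact: poweR_ge0.
- by apply: mp; exact: measurable_funD.
apply: ae_imp h => w hw _; rewrite /= lee_fin ge0_ler_powR ?nnegrE//.
rewrite ger0_norm ?L2norm_ge0//; apply: (le_trans hw).
exact: ler_norm.
Qed.

Lemma L2Om_normD X Y : wm X -> wm Y ->
  (L2Om_norm P (fun w => (X w + Y w)%R) <= L2Om_norm P X + L2Om_norm P Y)%E.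
Proof.
move=> mX mY; rewrite -[X in (_ <= X + _)%E]mul1e -[X in (_ <= _ + X)%E]mul1e.
apply: L2Om_norm_lin => //; first exact: weakly_measurableD.
by apply: aeW => w; rewrite !mul1r L2normD.
Qed.

Lemma eq_ae_L2Om_norm X Y : wm X -> wm Y -> {ae P, forall w, X w = Y w} ->
  L2Om_norm P X = L2Om_norm P Y.
Proof.
suff le Z Z' : wm Z -> wm Z' -> {ae P, forall w, Z w = Z' w} ->
    (L2Om_norm P Z <= L2Om_norm P Z')%E.
  move=> mX mY XY; apply/eqP; rewrite eq_le !le//.
  by apply: ae_imp XY => w ->.
move=> mZ mZ' ZZ.
have := @L2Om_norm_lin Z' Z' Z 1 0 ler01 (lexx 0) mZ' mZ' mZ.
rewrite mul0e adde0 mul1e; apply.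
by apply: ae_imp ZZ => w ->; rewrite mul1r mul0r addr0.
Qed.

Lemma L2Om_norm_eq0 X : wm X -> (forall eps : R, 0 < eps -> (L2Om_norm P X < eps%:E)%E) ->
  {ae P, forall w, X w = 0}.
Proof.
move=> mX h; have X0 : L2Om_norm P X = 0%E.
  apply/eqP; rewrite eq_le L2Om_norm_ge0 andbT.
  by apply/lee_addgt0Pr => eps eps0; rewrite add0e ltW// h.
have mN : measurable_fun setT (EFin \o @L2norm R \o X).
  by apply/measurable_EFinP; exact: mnorm mX.
have := Lnorm_eq0_eq0 mN (_ : (0 < 2%:E)%E) X0.
rewrite lte_fin ltr0n => /(_ isT); apply: ae_imp => w /= /(_ I) [].
exact: L2norm0_eq0.
Qed.

Lemma L2Om_norm_semigroup t X : 0 <= alpha -> 0 <= t -> wm X ->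
  (L2Om_norm P (fun w => S t (X w)) <= L2Om_norm P X)%E.
Proof.
move=> a0 t0 mX.
have := @L2Om_norm_lin X X (fun w => S t (X w)) 1 0 ler01 (lexx 0) mX mX.
rewrite mul0e adde0 mul1e; apply.
  exact: (weakly_measurable_semigroup S_semi t0 mX).
apply: aeW => w; rewrite mul1r mul0r addr0.
apply: le_trans (semigroup_contr S_semi (X w) t0) _.
rewrite ler_piMl ?L2norm_ge0// -expR0 ler_expR oppr_le0 mulr_ge0//.
Qed.

Lemma L2Om_normN X : L2Om_norm P (fun w => (- X w)%R) = L2Om_norm P X.
Proof. by apply: eq_Lnorm => w /=; rewrite L2normN. Qed.

(** Propagators and iterates are specified only up to null sets; completeness of [P] is what makes
    this harmless for measurability. *)
Lemma ae_eq_weakly_measurable X Y : measure_is_complete P ->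
  {ae P, forall w, X w = Y w} -> wm Y -> wm X.
Proof.
move=> cP XY mY m m0; have [Yr Yi] := mY m m0.
split; apply/measurable_EFinP.
- move/measurable_EFinP : Yr; apply: (ae_measurable_fun cP).
  by apply: ae_imp XY => w /= ->.
- move/measurable_EFinP : Yi; apply: (ae_measurable_fun cP).
  by apply: ae_imp XY => w /= ->.
Qed.

Lemma measurableL2_weak X : measurableL2 measurable X -> wm X.
Proof.
move=> mX; apply: open_weakly_measurable => // U oU.
by rewrite setTI; exact: mX.
Qed.

End L2Om.

(** * Flow property of the stochastic convolution *)

Section wiener_flow.
Context {R : realType} {d : measure_display} {Om : measurableType d}.
Variable P : probability Om R.
Local Notation H := (L2C R).
Local Notation e := (@sine_basis R).
Local Notation leb := (@lebesgue_measure R).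

Variables (alpha : R) (S : R -> H -> H).
Hypothesis alpha_ge0 : 0 <= alpha.
Hypothesis S_semi : is_semigroup alpha S.

Lemma measurable_Cexp_time (c : R[i]) :
  measurable_fun [set: R] (fun r : R => Re (Cexp (r%:C * c))) /\
  measurable_fun [set: R] (fun r : R => Im (Cexp (r%:C * c))).
Proof.
have cl (a : R) : continuous (fun x : R => x * a) by move=> x; apply: cvgM => //; exact: cvg_cst.
have me : measurable_fun [set: R] (fun r : R => expR (r * Re c)).
  apply: (measurableT_comp (f := @expR R)); first exact: measurable_expR.
  by apply: continuous_measurable_fun; exact: cl.
have ms : measurable_fun [set: R] (fun r : R => sin (r * Im c)).
  apply: (measurableT_comp (f := @sin R)).
    by apply: continuous_measurable_fun; exact: continuous_sin.
  by apply: continuous_measurable_fun; exact: cl.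
have mc : measurable_fun [set: R] (fun r : R => cos (r * Im c)).
  apply: (measurableT_comp (f := @cos R)).
    by apply: continuous_measurable_fun; exact: continuous_cos.
  by apply: continuous_measurable_fun; exact: cl.
have Er (r : R) : Re (r%:C * c) = r * Re c by rewrite cReM/= mul0r subr0.
have Ei (r : R) : Im (r%:C * c) = r * Im c by rewrite cImM/= mul0r addr0.
split.
- apply: eq_measurable_fun (measurable_funM me mc) => r _ .
  by rewrite /Cexp Er Ei.
- apply: eq_measurable_fun (measurable_funM me ms) => r _.
  by rewrite /Cexp Er Ei.
Qed.

Lemma weakly_measurable_time (t : R) (D : set R) (h : H) :
  (forall r, D r -> r <= t) -> weakly_measurable D (fun r => S (t - r) h).
Proof.
move=> Dt m m0.
have [Xr Xi] := measurable_Cexp_time (Lambda_eigenvalue alpha m).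
pose c := Cexp (- (t%:C * Lambda_eigenvalue alpha m)) * L2inner h (e m).
have E r : D r -> L2inner (S (t - r) h) (e m) =
    Cexp (r%:C * Lambda_eigenvalue alpha m) * c.
  move=> /Dt rt; rewrite (semigroup_coord S_semi) ?subr_ge0//; rewrite /c mulrA -CexpD.
  by congr (Cexp _ * _); rewrite rmorphB/=; ring.
have [Yr Yi] := (@measurable_funTS _ _ _ _ D _ Xr, @measurable_funTS _ _ _ _ D _ Xi).
have Zr a : measurable_fun D (fun r : R => Re (Cexp (r%:C * Lambda_eigenvalue alpha m)) * a).
  exact: measurable_funM.
have Zi a : measurable_fun D (fun r : R => Im (Cexp (r%:C * Lambda_eigenvalue alpha m)) * a).
  exact: measurable_funM.
split.
- apply: eq_measurable_fun (measurable_funB (Zr (Re c)) (Zi (Im c))) => r.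
  by rewrite inE => /E ->; rewrite cReM.
- apply: eq_measurable_fun (measurable_funD (Zr (Im c)) (Zi (Re c))) => r.
  by rewrite inE => /E ->; rewrite cImM.
Qed.

Lemma weakly_measurable_elem (D : set R) (E : seq elem_term) m :
  weakly_measurable D (fun r => elem_apply E r m : H).
Proof.
elim: E => [|x E IH].
  rewrite (_ : (fun r => _) = (fun=> 0)); first exact: weakly_measurable_cst.
  by apply/funext => r; rewrite /elem_apply big_nil.
pose c (r : R) : R[i] := (((et_m x == m) && (et_a x < r <= et_b x))%:R : R)%:C.
rewrite (_ : (fun r => _) = (fun r => c r *: et_h x + elem_apply E r m)).
  apply: weakly_measurableD => //; apply: weakly_measurableZ.
  - rewrite (_ : (fun w => _) = (fun r => (et_m x == m)%:R * \1_(`]et_a x, et_b x]%classic) r)).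
      by apply: measurable_funM => //; apply: measurable_funTS; exact: measurable_indic.
    apply/funext => r; rewrite indicE mem_setE in_itv/=.
    by case: (et_m x == m); rewrite ?mul1r ?mul0r.
  - exact: measurable_cst.
  - exact: weakly_measurable_cst.
apply/funext => r; rewrite /elem_apply big_cons /c.
by case: ifP => _ /=; rewrite ?scale1r ?scale0r ?add0r.
Qed.

Definition semigroup_elem (t : R) (E : seq (@elem_term R)) : seq (@elem_term R) :=
  [seq ElemTerm (et_m x) (et_a x) (et_b x) (S t (et_h x)) | x <- E].

Lemma semigroup_elem_apply t E r m : 0 <= t ->
  elem_apply (semigroup_elem t E) r m = S t (elem_apply E r m).
Proof.
by move=> t0; rewrite /elem_apply (semigroup_sum S_semi)// big_map.
Qed.

Lemma semigroup_elem_integral (beta : nat -> R -> Om -> R[i]) t E w : 0 <= t ->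
  elem_integral beta (semigroup_elem t E) w = S t (elem_integral beta E w).
Proof.
move=> t0; rewrite /elem_integral (semigroup_sum S_semi)// big_map.
by apply: eq_bigr => x _ /=; rewrite (semigroupZ S_semi).
Qed.

Lemma elem_apply_out s t E r m : elem_on s t E -> ~~ (s < r <= t) ->
  elem_apply E r m = 0 :> H.
Proof.
move=> Eon rst; rewrite /elem_apply; elim: E Eon => [|x E IH /=].
  by rewrite big_nil.
move=> /andP[/and4P[_ sa ab bt] /IH {}IH]; rewrite big_cons IH.
case: ifP => // /andP[_ /andP[ar rb]].
by move: rst; rewrite (le_lt_trans sa ar) (le_trans rb bt).
Qed.

Section flow.
Variables (Qh : H -> H).

(** On [0, s] the integrand factors as [S (t - r) = S (t - s) S (s - r)], and the contraction
    [S (t - s)] does not increase the distance to [E1]; on (s, t] only [E2] is active. *)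
Lemma elem_dist2_cat (s t : R) (E1 E2 : seq (@elem_term R)) : 0 <= s -> s <= t ->
  elem_on 0 s E1 -> elem_on s t E2 ->
  (elem_dist2 0 t (fun r f => S (t - r) (Qh f)) (semigroup_elem (t - s) E1 ++ E2) <=
   elem_dist2 0 s (fun r f => S (s - r) (Qh f)) E1 +
   elem_dist2 s t (fun r f => S (t - r) (Qh f)) E2)%E.
Proof.
move=> s0 st E1s E2s; rewrite /elem_dist2 -nneseriesD; last 2 first.
- by move=> m _ _; apply: integral_ge0 => r _; rewrite lee_fin sqr_ge0.
- by move=> m _ _; apply: integral_ge0 => r _; rewrite lee_fin sqr_ge0.
apply: lee_nneseries => [m _ _|m _].
  by apply: integral_ge0 => r _; rewrite lee_fin sqr_ge0.
have mF (D : set R) (u : R) E : (forall r, D r -> r <= u) ->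
    measurable_fun D (fun r : R => (L2norm (S (u - r) (Qh (e m)) - elem_apply E r m) ^+ 2)%:E).
  move=> Du; apply/measurable_EFinP; apply: measurable_funX.
  apply: (weakly_measurable_norm S_semi); apply: weakly_measurableB.
    exact: weakly_measurable_time.
  exact: weakly_measurable_elem.
have catE r : elem_apply (semigroup_elem (t - s) E1 ++ E2) r m =
    S (t - s) (elem_apply E1 r m) + elem_apply E2 r m.
  by rewrite -semigroup_elem_apply ?subr_ge0// /elem_apply big_cat.
(* The cut is half-open since elementary terms live on intervals (a, b]: those of [E1] may include
   [s], those of [E2] begin strictly after it. *)
have split_itv : `[0, t]%classic = `[0, s]%classic `|` `]s, t]%classic :> set R.
  by rewrite -itv_bndbnd_setU//= bnd_simp.
have m1 : measurable (`[0, s]%classic : set (measurableTypeR R)) by [].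
have m2 : measurable (`]s, t]%classic : set (measurableTypeR R)) by [].
have disj : [disjoint `[0, s]%classic & `]s, t]%classic : set R].
  rewrite disj_set2E; apply/eqP/seteqP; split => // r [] /=.
  by rewrite !in_itv/= => /andP[_ rs] /andP[sr _]; move: (lt_le_trans sr rs); rewrite ltxx.
rewrite split_itv (ge0_integral_setU _ m1 m2 _ _ disj); last first.
- by move=> r _; rewrite lee_fin sqr_ge0.
- apply: mF => r [] /=; rewrite !in_itv/= => /andP[_ rs] //.
  exact: le_trans st.
apply: leeD.
- apply: ge0_le_integral => //=.
  + by move=> r _; rewrite lee_fin sqr_ge0.
  + by apply: mF => r /=; rewrite in_itv/= => /andP[_ rs]; exact: le_trans st.
  + by apply: mF => r /=; rewrite in_itv/= => /andP[_ rs].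
  + move=> r; rewrite /= in_itv/= => /andP[r0 rs].
    rewrite lee_fin ler_sqr ?nnegrE ?L2norm_ge0// catE (elem_apply_out _ E2s); last first.
      by rewrite ltNge rs.
    rewrite addr0.
    have -> : S (t - r) (Qh (e m)) = S (t - s) (S (s - r) (Qh (e m))).
      by rewrite (semigroup_comp S_semi) ?subr_ge0//; congr (S _ _); ring.
    rewrite -(semigroupB S_semi) ?subr_ge0//.
    apply: le_trans (semigroup_contr S_semi _ _) _; first by rewrite subr_ge0.
    rewrite ler_piMl ?L2norm_ge0// -expR0 ler_expR oppr_le0 mulr_ge0// subr_ge0//.
- apply: (@le_trans _ _ (\int[leb]_(r in `]s, t])
      (L2norm (S (t - r) (Qh (e m)) - elem_apply E2 r m) ^+ 2)%:E)%E).
    rewrite le_eqVlt; apply/orP; left; apply/eqP/eq_integral => r.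
    rewrite inE/= in_itv/= => /andP[sr rt]; rewrite catE (elem_apply_out _ E1s).
      by rewrite -{1}(scale0r 0) (semigroupZ S_semi) ?subr_ge0// scale0r add0r.
    by rewrite (leNgt r s) sr andbF.
  apply: ge0_subset_integral => //=.
  + by apply: mF => r /=; rewrite in_itv/= => /andP[_ rs].
  + by move=> r _; rewrite lee_fin sqr_ge0.
  + by apply: subset_itv; rewrite bnd_simp.
Qed.

Variables (B : R -> set (set Om)) (beta : nat -> R -> Om -> R[i]).
Hypothesis Bfilt : complete_filtration P B.
Hypothesis Wbeta : cylindrical_wiener P B beta.

Lemma weakly_measurable_elem_integral (s t : R) (E : seq (@elem_term R)) : 0 <= s ->
  elem_on s t E -> weakly_measurable setT (elem_integral beta E).
Proof.
move=> s0; elim: E => [_|x E IH /= /andP[/and4P[m0 sa ab bt] /IH {}IH]].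
  rewrite (_ : elem_integral _ _ = (fun=> 0)); first exact: weakly_measurable_cst.
  by apply/funext => w; rewrite /elem_integral big_nil.
have mb u : 0 <= u -> measurable_fun setT (fun w => Re (beta (et_m x) u w)) /\
    measurable_fun setT (fun w => Im (beta (et_m x) u w)).
  move=> u0; split=> _ A mA; rewrite setTI; apply: (cf_sub Bfilt u0);
    by have [] := cw_adapted Wbeta m0 u0 mA.
have [ar ai] := mb _ (le_trans s0 sa).
have [br bi] := mb _ (le_trans s0 (le_trans sa ab)).
rewrite (_ : elem_integral _ _ = (fun w => (beta (et_m x) (et_b x) w -
    beta (et_m x) (et_a x) w) *: et_h x + elem_integral beta E w)); last first.
  by apply/funext => w; rewrite /elem_integral big_cons.
apply: weakly_measurableD => //; apply: weakly_measurableZ.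
- by apply: eq_measurable_fun (measurable_funB br ar) => w _; rewrite cReD cReN.
- by apply: eq_measurable_fun (measurable_funB bi ai) => w _; rewrite cImD cImN.
- exact: weakly_measurable_cst.
Qed.

(* If [E1] and [E2] approximate the integrands on [0, s] and [s, t], then
   [S(t - s) E1 ++ E2] approximates the one on [0, t]. *)
Lemma wiener_flow (s t : R) Z0s Zst Z0t : 0 <= s -> s <= t ->
  is_wiener_integral P beta 0 s (fun r f => S (s - r) (Qh f)) Z0s ->
  is_wiener_integral P beta s t (fun r f => S (t - r) (Qh f)) Zst ->
  is_wiener_integral P beta 0 t (fun r f => S (t - r) (Qh f)) Z0t ->
  {ae P, forall w, Z0t w = S (t - s) (Z0s w) + Zst w}.
Proof.
move=> s0 st [m1 d1 l1] [m2 d2 l2] [m3 d3 l3].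
have ts0 : 0 <= t - s by rewrite subr_ge0.
have w1 := measurableL2_weak m1; have w2 := measurableL2_weak m2.
have w3 := measurableL2_weak m3.
have wS : weakly_measurable setT (fun w => S (t - s) (Z0s w)).
  exact: (weakly_measurable_semigroup S_semi ts0 w1).
have wD : weakly_measurable setT (fun w => Z0t w - S (t - s) (Z0s w) - Zst w).
  by apply: weakly_measurableB => //; exact: weakly_measurableB.
suff : {ae P, forall w, Z0t w - S (t - s) (Z0s w) - Zst w = 0}.
  by apply: ae_imp => w /eqP; rewrite -addrA -opprD subr_eq0 => /eqP.
apply: (L2Om_norm_eq0 S_semi wD) => eps eps0.
have eps3 : 0 < eps / 3 by rewrite divr_gt0.
have [e1 e10 h1] := l1 _ eps3.
have [e2 e20 h2] := l2 _ eps3.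
have [e3 e30 h3] := l3 _ eps3.
(* [E1] has to be fine enough for its own integral and, with one half of [e3], for the concatenation
   over [0, t]; [E2] likewise with the other half. *)
have [|E1 E1s E1d] := d1 (Num.min e1 (e3 / 2)).
  by rewrite lt_min e10 divr_gt0.
have [|E2 E2s E2d] := d2 (Num.min e2 (e3 / 2)).
  by rewrite lt_min e20 divr_gt0.
have {}h1 := h1 _ E1s (lt_le_trans E1d _).
have {}h1 : (L2Om_norm P (fun w => (Z0s w - elem_integral beta E1 w)%R) < (eps / 3)%:E)%E.
  by apply: h1; rewrite lee_fin ge_min lexx.
have {}h2 := h2 _ E2s (lt_le_trans E2d _).
have {}h2 : (L2Om_norm P (fun w => (Zst w - elem_integral beta E2 w)%R) < (eps / 3)%:E)%E.
  by apply: h2; rewrite lee_fin ge_min lexx.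
pose E := semigroup_elem (t - s) E1 ++ E2.
have Eon : elem_on 0 t E.
  rewrite /elem_on all_cat all_map; apply/andP; split.
    apply: sub_all E1s => x /and4P[m0 a0 ab bs] /=.
    by rewrite m0 a0 ab (le_trans bs st).
  apply: sub_all E2s => x /and4P[m0 sa ab bt].
  by rewrite m0 (le_trans s0 sa) ab bt.
have Ed : (elem_dist2 0 t (fun r f => S (t - r) (Qh f)) E < e3%:E)%E.
  apply: le_lt_trans (elem_dist2_cat s0 st E1s E2s) _.
  rewrite (splitr e3) EFinD; apply: lteD.
    by apply: (lt_le_trans E1d); rewrite lee_fin ge_min lexx orbT.
  by apply: (lt_le_trans E2d); rewrite lee_fin ge_min lexx orbT.
have {}h3 := h3 _ Eon Ed.
have wE1 := weakly_measurable_elem_integral (lexx 0) E1s.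
have wE2 := weakly_measurable_elem_integral s0 E2s.
have wE := weakly_measurable_elem_integral (lexx 0) Eon.
have wa := weakly_measurableB w3 wE.
have wb := weakly_measurableB w1 wE1.
have wc := weakly_measurableB w2 wE2.
have wSb := weakly_measurable_semigroup S_semi ts0 wb.
have Eeq w : Z0t w - S (t - s) (Z0s w) - Zst w =
    ((Z0t w - elem_integral beta E w) +
     - S (t - s) (Z0s w - elem_integral beta E1 w)) +
    - (Zst w - elem_integral beta E2 w).
  have -> : elem_integral beta E w =
      S (t - s) (elem_integral beta E1 w) + elem_integral beta E2 w.
    by rewrite -semigroup_elem_integral// /elem_integral big_cat.
  rewrite (semigroupB S_semi)//.
  move: (S _ (Z0s w)) (S _ (elem_integral beta E1 w)) (elem_integral beta E2 w) => x y z.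
  by rewrite -!addrA -!opprD addrACA (addrC y) subrK (addrC z) subrK.
under eq_fun do rewrite Eeq.
have wN (X : Om -> H) : weakly_measurable setT X -> weakly_measurable setT (fun w => - X w).
  move=> wX; have := weakly_measurableZc (-1) wX.
  by under eq_fun do rewrite scaleN1r.
apply: le_lt_trans (L2Om_normD P S_semi _ (wN _ wc)) _.
  by apply: weakly_measurableD => //; exact: wN.
rewrite L2Om_normN (_ : eps = eps / 3 + eps / 3 + eps / 3); last by field.
rewrite EFinD; apply: lteD => //.
apply: le_lt_trans (L2Om_normD P S_semi wa (wN _ wSb)) _.
rewrite L2Om_normN EFinD; apply: lteD => //.
exact: le_lt_trans (L2Om_norm_semigroup P S_semi alpha_ge0 ts0 wb) h1.
Qed.

End flow.
End wiener_flow.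

(** * A rotation equation solved almost everywhere in time *)

Section rotation.
Context {R : realType}.
Local Notation leb := (@lebesgue_measure R).

Lemma derive_zero_itv (f : R -> R) (s T : R) : s < T ->
  (forall x, x \in `]s, T[ -> is_derive x 1 f 0) ->
  {within `[s, T], continuous f} -> f T = f s.
Proof.
move=> sT df cf; have [c _] := @MVT R f (cst 0) s T sT df cf.
by rewrite mul0r => /eqP; rewrite subr_eq0 => /eqP.
Qed.

(** The fundamental theorem needs a continuous integrand: [b] is replaced under the integral by its
    continuous version [B]. *)
Lemma continuous_integral_equation (s T k a0 : R) (a b B : R -> R) : s < T ->
  leb.-integrable `[s, T] (EFin \o b) -> {within `[s, T], continuous B} ->
  {ae leb, forall r, r \in `[s, T] -> b r = B r} ->
  forall r, r \in `]s, T[ ->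
  is_derive r 1 (fun x => a0 + k * \int[leb]_(y in `[s, x]) b y) (k * B r).
Proof.
move=> sT ib cB bB r rsT.
have [sr rT] : s < r /\ r < T by move: rsT; rewrite in_itv/= => /andP[].
have iB : leb.-integrable `[s, T] (EFin \o B).
  apply: continuous_compact_integrable => //; exact: segment_compact.
have /(continuous_within_itvP _ sT)[cBo _ _] := cB.
have [dI vI] := @continuous_FTC1_closed R B s r T rT iB sr (cBo r rsT).
have dB : is_derive r 1 (fun x => \int[leb]_(y in `[s, x]) B y) (B r).
  apply: DeriveDef; first exact: dI.
  by rewrite -vI derive1E.
have db : is_derive r 1 (fun x => \int[leb]_(y in `[s, x]) b y) (B r).
  apply: (near_eq_is_derive (f := fun x => \int[leb]_(y in `[s, x]) B y)) => //.
  near=> x.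
  have xT : x <= T by apply/ltW; near: x; exact: lt_nbhsl.
  have sub : `[s, x]%classic `<=` `[s, T]%classic.
    by apply: subset_itvl; rewrite bnd_simp.
  have iBx : leb.-integrable `[s, x] (EFin \o B) by apply: integrableS iB.
  have ibx : leb.-integrable `[s, x] (EFin \o b) by apply: integrableS ib.
  congr fine; apply: ae_eq_integral => //.
  - exact: measurable_int iBx.
  - exact: measurable_int ibx.
  - apply: ae_imp bB => y h xy; rewrite /= h//.
    exact: sub.
by apply: is_derive_eq; rewrite add0r mul1r.
Unshelve. all: by end_near. Qed.

(** The conclusion is about the right-hand sides at [T], not about [a T] and [b T]: the hypothesis
    holds for almost every time only, and [T] may be an exception. The right-hand sides are
    continuous and solve a genuine differential equation. *)
Lemma integral_rotation (s T lam a0 b0 : R) (a b : R -> R) : s < T ->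
  leb.-integrable `[s, T] (EFin \o a) -> leb.-integrable `[s, T] (EFin \o b) ->
  {ae leb, forall r, r \in `[s, T] ->
     a r = a0 - lam * \int[leb]_(y in `[s, r]) b y /\
     b r = b0 + lam * \int[leb]_(y in `[s, r]) a y} ->
  a0 - lam * \int[leb]_(y in `[s, T]) b y =
    cos (lam * (T - s)) * a0 - sin (lam * (T - s)) * b0 /\
  b0 + lam * \int[leb]_(y in `[s, T]) a y =
    cos (lam * (T - s)) * b0 + sin (lam * (T - s)) * a0.
Proof.
move=> sT ia ib ab.
pose A x := a0 + - lam * \int[leb]_(y in `[s, x]) b y.
pose B x := b0 + lam * \int[leb]_(y in `[s, x]) a y.
have cont f c k : leb.-integrable `[s, T] (EFin \o f) ->
    {within `[s, T], continuous (fun x => c + k * \int[leb]_(y in `[s, x]) f y)}.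
  move=> /(parameterized_integral_continuous (ltW sT)) h x.
  apply: cvgD; first exact: cvg_cst.
  by apply: cvgM; [exact: cvg_cst|exact: h].
have cA : {within `[s, T], continuous A} by exact: cont.
have cB : {within `[s, T], continuous B} by exact: cont.
have aA : {ae leb, forall r, r \in `[s, T] -> a r = A r}.
  by apply: ae_imp ab => r h /h[-> _]; rewrite /A mulNr.
have bB : {ae leb, forall r, r \in `[s, T] -> b r = B r}.
  by apply: ae_imp ab => r h /h[_ ->].
have dA r : r \in `]s, T[ -> is_derive r 1 A (- lam * B r).
  exact: continuous_integral_equation.
have dB r : r \in `]s, T[ -> is_derive r 1 B (lam * A r).
  exact: continuous_integral_equation.
pose c x := cos (lam * (x - s)); pose d x := sin (lam * (x - s)).
have dlin (x : R) : is_derive x 1 (fun x : R => lam * (x - s)) lam.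
  by apply: is_derive_eq; rewrite subr0 [LHS]mulr1.
have dc (x : R) : is_derive x 1 c (- d x * lam).
  exact: (@is_derive1_comp R cos (fun x => lam * (x - s)) x _ _ (is_derive_cos _) (dlin x)).
have dd (x : R) : is_derive x 1 d (c x * lam).
  exact: (@is_derive1_comp R sin (fun x => lam * (x - s)) x _ _ (is_derive_sin _) (dlin x)).
have cc : continuous c by move=> x; apply/differentiable_continuous/derivable1_diffP.
have cd : continuous d by move=> x; apply/differentiable_continuous/derivable1_diffP.
have cW (f g : R -> R) : {within `[s, T], continuous f} -> continuous g ->
    {within `[s, T], continuous (fun x => f x * g x)}.
  by move=> cf cg x; apply: cvgM; [exact: cf|exact: continuous_subspaceT].
(* [A c + B d] and [B c - A d] are the real and imaginary parts of
   [exp (- i lam (x - s)) (A + i B)], which has derivative 0. *)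
have p_eq : A T * c T + B T * d T = A s * c s + B s * d s.
  apply: (@derive_zero_itv (fun x => A x * c x + B x * d x) s T sT) => [x xsT|].
    have dAx := dA x xsT; have dBx := dB x xsT.
    apply: is_derive_eq; rewrite /GRing.scale/=; ring.
  by move=> x; apply: cvgD; apply: cW.
have q_eq : B T * c T - A T * d T = B s * c s - A s * d s.
  apply: (@derive_zero_itv (fun x => B x * c x - A x * d x) s T sT) => [x xsT|].
    have dAx := dA x xsT; have dBx := dB x xsT.
    apply: is_derive_eq; rewrite /GRing.scale/=; ring.
  by move=> x; apply: cvgB; apply: cW.
have As : A s = a0 by rewrite /A set_itv1 Rintegral_set1 mulr0 addr0.
have Bs : B s = b0 by rewrite /B set_itv1 Rintegral_set1 mulr0 addr0.
have cs : c s = 1 by rewrite /c subrr mulr0 cos0.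
have ds : d s = 0 by rewrite /d subrr mulr0 sin0.
move: p_eq q_eq; rewrite As Bs cs ds => p q.
rewrite -mulNr -/(A T) -/(B T) -/(c T) -/(d T).
have cd1 : c T ^+ 2 + d T ^+ 2 = 1 by exact: cos2Dsin2.
have p1 : A T * c T + B T * d T = a0 by rewrite p; ring.
have q1 : B T * c T - A T * d T = b0 by rewrite q; ring.
rewrite -p1 -q1; split.
- by transitivity (A T * (c T ^+ 2 + d T ^+ 2)); [rewrite cd1 mulr1|ring].
- by transitivity (B T * (c T ^+ 2 + d T ^+ 2)); [rewrite cd1 mulr1|ring].
Qed.

End rotation.

Section fubini_time.
Context {R : realType} {d : measure_display} {Om : measurableType d}.
Variable P : probability Om R.
Local Notation leb := (@lebesgue_measure R).

(** By Tonelli the nonnegative function [w |-> leb (ysection N w)] has integral 0. *)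
Lemma ae_ysection_null (N : set (measurableTypeR R * Om)) : measurable N ->
  (forall t, P (xsection N t) = 0%E) -> {ae P, forall w, leb (ysection N w) = 0%E}.
Proof.
move=> mN N0.
have := indic_fubini_tonelli leb P mN.
rewrite indic_fubini_tonelli_FE// indic_fubini_tonelli_GE//.
rewrite integral0_eq; last by move=> t _ /=; exact: N0.
move=> /esym G0; have mG : measurable_fun setT (leb \o ysection N).
  by rewrite -indic_fubini_tonelli_GE//; exact: indic_measurable_fun_fubini_tonelli_G.
have := (ae_eq_integral_abs P measurableT mG).1; rewrite (_ : integral _ _ _ = 0%E).
  by move=> /(_ erefl); apply: ae_imp => w /(_ I).
by rewrite -[RHS]G0; apply: eq_integral => w _; rewrite gee0_abs.
Qed.

(** The variable upper limit becomes an indicator in an additional variable, after which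
    measurability of a parameter integral applies to the positive and negative parts. No
    integrability is required, [fine] being measurable everywhere. *)
Lemma measurable_time_integral (s : R) (b : measurableTypeR R * Om -> R) :
  measurable_fun setT b ->
  measurable_fun setT (fun z : measurableTypeR R * Om =>
    \int[leb]_(r in `[s, z.1]) b (r, z.2)).
Proof.
move=> mb.
pose F (y : (measurableTypeR R * Om) * measurableTypeR R) : R :=
  (s <= y.2 <= y.1.1)%R%:R * b (y.2, y.1.2).
have m2 : measurable_fun setT (fun y : (measurableTypeR R * Om) * measurableTypeR R => y.2).
  exact: measurable_snd.
have m11 : measurable_fun setT (fun y : (measurableTypeR R * Om) * measurableTypeR R => y.1.1).
  exact: (measurableT_comp measurable_fst measurable_fst).
have m12 : measurable_fun setT (fun y : (measurableTypeR R * Om) * measurableTypeR R => y.1.2).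
  exact: (measurableT_comp measurable_snd measurable_fst).
have mF : measurable_fun setT F.
  apply: measurable_funM; last first.
    by apply: (measurableT_comp mb); exact: measurable_fun_pair.
  pose D := [set y : (measurableTypeR R * Om) * measurableTypeR R | s <= y.2 <= y.1.1].
  rewrite (_ : (fun x => _) = \1_D); last first.
    by apply/funext => y; rewrite indicE mem_setE.
  apply: measurable_indic.
  have mD : measurable_fun setT
      (fun y : (measurableTypeR R * Om) * measurableTypeR R => s <= y.2 <= y.1.1).
    by apply: measurable_and; apply: measurable_fun_ler.
  have := mD measurableT [set true] I; rewrite setTI.
  by congr measurable; apply/seteqP; split.
rewrite (_ : (fun z => _) = (fun z => fine
    (fubini_F leb (EFin \o F)^\+ z - fubini_F leb (EFin \o F)^\- z)%E)).
  apply: (measurableT_comp (@fine_measurable R _ measurableT)).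
  apply: emeasurable_funB; apply: measurable_fun_fubini_tonelli_F => //.
  - by apply: measurable_funepos; exact/measurable_EFinP.
  - by apply: measurable_funeneg; exact/measurable_EFinP.
apply/funext => z; rewrite Rintegral_mkcond /Rintegral integralE.
have E : (fun r => (((fun r => b (r, z.2)) \_ `[s, z.1]) r)%:E) = (fun r => (F (z, r))%:E).
  apply/funext => r; rewrite patchE mem_setE in_itv/= /F/=.
  by case: ifP => _; rewrite ?mul1r ?mul0r.
rewrite E; congr fine; congr (_ - _)%E; rewrite /fubini_F;
  by apply: eq_integral => r _; rewrite ?funeposE ?funenegE.
Qed.

End fubini_time.

(** * Difference of two mild solutions driven by the same noise *)

Section mild.
Context {R : realType} {d : measure_display} {Om : measurableType d}.
Variable P : probability Om R.
Local Notation H := (L2C R).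
Local Notation e := (@sine_basis R).
Local Notation leb := (@lebesgue_measure R).

Variables (alpha lambda : R) (S : R -> H -> H) (Qh : H -> H).
Hypothesis alpha_ge0 : 0 <= alpha.
Hypothesis S_semi : is_semigroup alpha S.
Variables (B : R -> set (set Om)) (beta : nat -> R -> Om -> R[i]).
Hypothesis Bfilt : complete_filtration P B.
Hypothesis Wbeta : cylindrical_wiener P B beta.

Local Notation mild := (mild_solution P B beta S Qh lambda).
Local Notation Lam := (Lambda_eigenvalue alpha).

(* Multiplying by [exp(r Lambda)] removes the free evolution. *)
Definition rotated_coord (m : nat) (X : R -> Om -> H) (r : R) (w : Om) : R[i] :=
  Cexp (r%:C * Lam m) * L2inner (X r w) (e m).

(** Since [exp (t Lam) exp (- (t - r) Lam) = exp (r Lam)], the integrand ceases to depend on the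
    upper limit [t], and the convolution becomes an ordinary integral. *)
Lemma mild_coord (m : nat) (s t : R) v X Z J w : (0 < m)%N -> s <= t ->
  is_L2integral s t (fun r => S (t - r) (X r w)) J ->
  X t w = S (t - s) (v w) + (0 +i* lambda) *: J + Z w ->
  cintegrable leb `[s, t] (rotated_coord m X ^~ w) /\
  rotated_coord m X t w = Cexp (s%:C * Lam m) * L2inner (v w) (e m) +
    (0 +i* lambda) * cintegral leb `[s, t] (rotated_coord m X ^~ w) +
    Cexp (t%:C * Lam m) * L2inner (Z w) (e m).
Proof.
move=> m0 st [_ Jr Ji JE] Xt.
have iJ : cintegrable leb `[s, t] (fun r => L2inner (S (t - r) (X r w)) (e m)) by [].
have rotE r : r \in `[s, t]%classic ->
    Cexp (t%:C * Lam m) * L2inner (S (t - r) (X r w)) (e m) = rotated_coord m X r w.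
  rewrite inE/= in_itv/= => /andP[_ rt].
  rewrite (semigroup_coord S_semi) ?subr_ge0// mulrA -CexpD; congr (Cexp _ * _).
  by rewrite rmorphB/=; ring.
have iC : cintegrable leb `[s, t] (rotated_coord m X ^~ w).
  apply: (@eq_cintegrable _ _ R leb _ (fun r => Cexp (t%:C * Lam m) *
    L2inner (S (t - r) (X r w)) (e m))) => //; exact: cintegrableZ.
split => //.
have cE : cintegral leb `[s, t] (rotated_coord m X ^~ w) =
    Cexp (t%:C * Lam m) * L2inner J (e m).
  transitivity (cintegral leb `[s, t] (fun r =>
      Cexp (t%:C * Lam m) * L2inner (S (t - r) (X r w)) (e m))).
    by apply: eq_cintegral => r rst; rewrite rotE.
  have mI : measurable (`[s, t]%classic : set (measurableTypeR R)) by [].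
  rewrite JE; exact: (cintegralZ (Cexp (t%:C * Lam m)) mI iJ).
rewrite cE.
rewrite {1}/rotated_coord Xt !L2innerDl L2innerZl (semigroup_coord S_semi) ?subr_ge0//.
rewrite !mulrDr mulrA -CexpD; congr (Cexp _ * _ + _ + _).
  by rewrite rmorphB/=; ring.
by rewrite mulrCA.
Qed.

(** The initial condition is not a field of [mild_solution]; it is the mild equation at [t = s],
    where both integrals run over one point and [S 0] is the identity. *)
Lemma mild_init s v X : mild s v X -> {ae P, forall w, X s w = v w}.
Proof.
move=> [_ _ /(_ s (lexx s)) [Z [mZ _ lZ] hX]].
have Z0 : {ae P, forall w, Z w = 0}.
  apply: (L2Om_norm_eq0 S_semi (measurableL2_weak mZ)) => eps eps0.
  have [delta delta0 h] := lZ _ eps0.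
  (* On the interval [s, s] the empty elementary integrand has distance 0 from any integrand, so [Z]
     is within every [eps] of 0. *)
  have := h [::] isT; rewrite /elem_dist2 eseries0.
    move=> /(_ delta0).
    rewrite (_ : (fun w => _) = Z)//; apply/funext => w.
    by rewrite /elem_integral big_nil subr0.
  by move=> m _ _; rewrite set_itv1 integral_set1.
apply: ae_imp2 Z0 hX => w -> [J [_ _ _ JE] ->].
have -> : J = 0.
  apply: (L2_sine_ext (R := R)) => m m0; rewrite L2inner0l JE !set_itv1.
  by rewrite !Rintegral_set1.
by rewrite subrr (semigroup0 S_semi) scaler0 !addr0.
Qed.

Lemma mild_wm s v X t : 0 <= s -> s <= t -> mild s v X -> weakly_measurable setT (X t).
Proof.
move=> s0 st mX; apply: measurableL2_weak => U oU.
by apply: (cf_sub Bfilt (le_trans s0 st)); exact: (ms_adapted mX).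
Qed.

Lemma mild_joint_wm s v X : 0 <= s -> mild s v X ->
  weakly_measurable [set z : measurableTypeR R * Om | s <= z.1] (fun z => X z.1 z.2).
Proof.
move=> s0 mX; apply: open_weakly_measurable => [|U oU].
  (* Joint measurability tested on the whole space says that the domain itself is measurable. *)
  have h : openL2 (setT : set H) by move=> f _; exists 1.
  have := ms_meas mX h; congr measurable.
  by apply/seteqP; split => z /= => [[]|].
exact: (ms_meas mX oU).
Qed.

Variables (u0 : Om -> H) (X : R -> Om -> H).
Hypothesis X_mild : mild 0 u0 X.
Variables (s : R) (v : Om -> H) (Y : R -> Om -> H).
Hypothesis s_ge0 : 0 <= s.
Hypothesis Y_mild : mild s v Y.

Definition rotated_diff m r w := rotated_coord m X r w - rotated_coord m Y r w.

(** [X] solves an equation from time 0 and [Y] one from time [s]. The equations of [X] at [t] and at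
    [s] are subtracted; by [wiener_flow] what remains of the noise is the integral over [s, t]
    driving [Y], and it cancels. The exceptional null set still depends on [t]. *)
Lemma rotated_diff_eq m t : (0 < m)%N -> s <= t ->
  {ae P, forall w, cintegrable leb `[s, t] (rotated_diff m ^~ w) /\
    rotated_diff m t w = rotated_diff m s w +
      (0 +i* lambda) * cintegral leb `[s, t] (rotated_diff m ^~ w)}.
Proof.
move=> m0 st.
have [Z0t wZ0t hXt] := ms_eq X_mild (le_trans s_ge0 st).
have [Z0s wZ0s hXs] := ms_eq X_mild s_ge0.
have [Zst wZst hYt] := ms_eq Y_mild st.
have flow := wiener_flow alpha_ge0 S_semi Bfilt Wbeta s_ge0 st wZ0s wZst wZ0t.
have init := mild_init Y_mild.
have hX : {ae P, forall w, (exists2 J, is_L2integral 0 t (fun r => S (t - r) (X r w)) J &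
    X t w = S (t - 0) (u0 w) + (0 +i* lambda) *: J + Z0t w) /\
    (exists2 J, is_L2integral 0 s (fun r => S (s - r) (X r w)) J &
    X s w = S (s - 0) (u0 w) + (0 +i* lambda) *: J + Z0s w)}.
  by apply: ae_imp2 hXt hXs.
have hY : {ae P, forall w, (exists2 J, is_L2integral s t (fun r => S (t - r) (Y r w)) J &
    Y t w = S (t - s) (v w) + (0 +i* lambda) *: J + Zst w) /\
    Y s w = v w /\ Z0t w = S (t - s) (Z0s w) + Zst w}.
  by apply: ae_imp3 hYt init flow.
apply: ae_imp2 hX hY => w [[J1 J1i eq1] [J2 J2i eq2]] [[J3 J3i eq3] [Ys Zw]].
have [i1 {}eq1] := mild_coord m0 (le_trans s_ge0 st) J1i eq1.
have [i2 {}eq2] := mild_coord m0 s_ge0 J2i eq2.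
have [i3 {}eq3] := mild_coord m0 st J3i eq3.
have sub : `[s, t]%classic `<=` `[0, t]%classic by apply: subset_itvr; rewrite bnd_simp.
have iX : cintegrable leb `[s, t] (rotated_coord m X ^~ w).
  by apply: cintegrableS i1.
have iN : cintegrable leb `[s, t] (fun r => -1 * rotated_coord m Y r w).
  exact: cintegrableZ.
have iD : cintegrable leb `[s, t] (rotated_diff m ^~ w).
  apply: (@eq_cintegrable _ _ R leb _
    (fun r => rotated_coord m X r w + -1 * rotated_coord m Y r w)) => //.
    by move=> r _; rewrite mulN1r.
  exact: cintegrableD.
split; first exact: iD.
have -> : cintegral leb `[s, t] (rotated_diff m ^~ w) =
    cintegral leb `[s, t] (rotated_coord m X ^~ w) -
    cintegral leb `[s, t] (rotated_coord m Y ^~ w).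
  rewrite -mulN1r -cintegralZ// -cintegralD//.
  by apply: eq_cintegral => r _; rewrite mulN1r.
have split_int : cintegral leb `[0, t] (rotated_coord m X ^~ w) =
    cintegral leb `[0, s] (rotated_coord m X ^~ w) +
    cintegral leb `[s, t] (rotated_coord m X ^~ w).
  have rsplit (f : R -> R) : leb.-integrable `[0, t] (EFin \o f) ->
      \int[leb]_(r in `[0, t]) f r =
      \int[leb]_(r in `[0, s]) f r + \int[leb]_(r in `[s, t]) f r.
    move=> fi; rewrite -[X in _ + X]Rintegral_itv_obnd_cbnd.
      rewrite -(Rintegral_itvB fi) ?bnd_simp//.
      by rewrite addrC subrK.
    by apply: integrableS fi => //; apply: subset_itvr; rewrite bnd_simp.
  by congr Complex; apply: rsplit; case: i1.
have sm0 : 0%:C * Lam m = 0 by rewrite mul0r.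
rewrite sm0 Cexp0 mul1r in eq1 eq2.
have Zm : Cexp (t%:C * Lam m) * L2inner (Z0t w) (e m) =
    Cexp (s%:C * Lam m) * L2inner (Z0s w) (e m) + Cexp (t%:C * Lam m) * L2inner (Zst w) (e m).
  rewrite Zw L2innerDl (semigroup_coord S_semi) ?subr_ge0// mulrDr mulrA -CexpD.
  by congr (Cexp _ * _ + _); rewrite rmorphB/=; ring.
rewrite /rotated_diff eq1 eq3 [rotated_coord m X s w]eq2 [rotated_coord m Y s w]/rotated_coord Ys.
have alg (a il I0 I1 I2 z1 z2 b : R[i]) :
    a + il * (I0 + I1) + (z1 + z2) - (b + il * I2 + z2) =
    a + il * I0 + z1 - b + il * (I1 - I2) by ring.
by rewrite Zm split_int alg.
Qed.

Lemma rotated_coord_measurable s' v' X' m : (0 < m)%N -> 0 <= s' -> mild s' v' X' ->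
  let D := [set z : measurableTypeR R * Om | s' <= z.1] in
  measurable_fun D (fun z => Re (rotated_coord m X' z.1 z.2)) /\
  measurable_fun D (fun z => Im (rotated_coord m X' z.1 z.2)).
Proof.
move=> m0 s0 mX D; have [Xr Xi] := mild_joint_wm s0 mX m0.
have [Cr Ci] := measurable_Cexp_time (Lam m).
have Cr' : measurable_fun D (fun z => Re (Cexp (z.1%:C * Lam m))).
  by apply: measurable_funTS; exact: (measurableT_comp Cr measurable_fst).
have Ci' : measurable_fun D (fun z => Im (Cexp (z.1%:C * Lam m))).
  by apply: measurable_funTS; exact: (measurableT_comp Ci measurable_fst).
split.
- apply: eq_measurable_fun (measurable_funB (measurable_funM Cr' Xr) (measurable_funM Ci' Xi)) => z _.
  by rewrite /rotated_coord cReM.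
- apply: eq_measurable_fun (measurable_funD (measurable_funM Cr' Xi) (measurable_funM Ci' Xr)) => z _.
  by rewrite /rotated_coord cImM.
Qed.

Lemma rotated_diff_ae_time m T : (0 < m)%N ->
  {ae P, forall w, {ae leb, forall r, r \in `[s, T] ->
    Re (rotated_diff m r w) = Re (rotated_diff m s w) -
      lambda * \int[leb]_(y in `[s, r]) Im (rotated_diff m y w) /\
    Im (rotated_diff m r w) = Im (rotated_diff m s w) +
      lambda * \int[leb]_(y in `[s, r]) Re (rotated_diff m y w)}}.
Proof.
move=> m0.
have [Xr Xi] := rotated_coord_measurable m0 (lexx 0) X_mild.
have [Yr Yi] := rotated_coord_measurable m0 s_ge0 Y_mild.
pose D := [set z : measurableTypeR R * Om | s <= z.1].
have meas_ge s' v' X' : mild s' v' X' ->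
    measurable [set z : measurableTypeR R * Om | s' <= z.1].
  move=> mX; have h : openL2 (setT : set H) by move=> f _; exists 1.
  have := ms_meas mX h; congr measurable.
  by apply/seteqP; split => z /= => [[]|].
have mI : measurable [set z : measurableTypeR R * Om | z.1 \in `[s, T]].
  have mf : measurable_fun setT (fst : measurableTypeR R * Om -> measurableTypeR R).
    exact: measurable_fst.
  have mI : measurable (`[s, T]%classic : set (measurableTypeR R)) by [].
  by have := mf measurableT _ mI; rewrite setTI.
have mD : measurable D by exact: meas_ge Y_mild.
have D0 : D `<=` [set z | 0 <= z.1] by move=> z /= sz; exact: le_trans sz.
have m00 := meas_ge _ _ _ X_mild.
have Xr' : measurable_fun D (fun z => Re (rotated_coord m X z.1 z.2)).
  exact: measurable_funS Xr.
have Xi' : measurable_fun D (fun z => Im (rotated_coord m X z.1 z.2)).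
  exact: measurable_funS Xi.
(* Joint measurability of [Y] is available only for times after [s]; extension by 0 gives functions
   measurable on the whole product, unchanged on [s, T]. *)
pose a := (fun z : measurableTypeR R * Om => Re (rotated_diff m z.1 z.2)) \_ D.
pose b := (fun z : measurableTypeR R * Om => Im (rotated_diff m z.1 z.2)) \_ D.
have ma : measurable_fun setT a.
  have mB : measurable_fun D (fun z => Re (rotated_diff m z.1 z.2)).
    rewrite (_ : (fun z => _) = (fun z => Re (rotated_coord m X z.1 z.2)) \-
      (fun z => Re (rotated_coord m Y z.1 z.2))); first exact: measurable_funB.
    by apply/funext => z; rewrite /rotated_diff cReD cReN.
  exact: (proj1 (measurable_restrictT _ mD) mB).
have mb : measurable_fun setT b.
  have mB : measurable_fun D (fun z => Im (rotated_diff m z.1 z.2)).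
    rewrite (_ : (fun z => _) = (fun z => Im (rotated_coord m X z.1 z.2)) \-
      (fun z => Im (rotated_coord m Y z.1 z.2))); first exact: measurable_funB.
    by apply/funext => z; rewrite /rotated_diff cImD cImN.
  exact: (proj1 (measurable_restrictT _ mD) mB).
have aE r w : s <= r -> a (r, w) = Re (rotated_diff m r w).
  by move=> sr; rewrite /a patchE mem_set.
have bE r w : s <= r -> b (r, w) = Im (rotated_diff m r w).
  by move=> sr; rewrite /b patchE mem_set.
have IaE r w : \int[leb]_(y in `[s, r]) a (y, w) =
    \int[leb]_(y in `[s, r]) Re (rotated_diff m y w).
  by apply: eq_Rintegral => y; rewrite inE/= in_itv/= => /andP[sy _]; exact: aE.
have IbE r w : \int[leb]_(y in `[s, r]) b (y, w) =
    \int[leb]_(y in `[s, r]) Im (rotated_diff m y w).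
  by apply: eq_Rintegral => y; rewrite inE/= in_itv/= => /andP[sy _]; exact: bE.
have ms : measurable_fun setT (fun z : measurableTypeR R * Om => ((s : measurableTypeR R), z.2)).
  by apply: measurable_fun_pair => //; exact: measurable_cst.
pose ea (z : measurableTypeR R * Om) :=
  a z - (a (s, z.2) - lambda * \int[leb]_(y in `[s, z.1]) b (y, z.2)).
pose eb (z : measurableTypeR R * Om) :=
  b z - (b (s, z.2) + lambda * \int[leb]_(y in `[s, z.1]) a (y, z.2)).
have mIa : measurable_fun setT (fun z : measurableTypeR R * Om =>
    \int[leb]_(y in `[s, z.1]) a (y, z.2)) := @measurable_time_integral _ _ _ s _ ma.
have mIb : measurable_fun setT (fun z : measurableTypeR R * Om =>
    \int[leb]_(y in `[s, z.1]) b (y, z.2)) := @measurable_time_integral _ _ _ s _ mb.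
have mea : measurable_fun setT ea.
  apply: (measurable_funB ma); apply: (measurable_funB (measurableT_comp ma ms)).
  exact: (measurable_funM (measurable_cst lambda) mIb).
have meb : measurable_fun setT eb.
  apply: (measurable_funB mb); apply: (measurable_funD (measurableT_comp mb ms)).
  exact: (measurable_funM (measurable_cst lambda) mIa).
(* The pairs (time, outcome) at which the equation fails: each section at a fixed time is null by
   [rotated_diff_eq], so almost every section at a fixed outcome is null too. *)
pose N := [set z : measurableTypeR R * Om | z.1 \in `[s, T]] `&`
  ~` (ea @^-1` [set 0] `&` eb @^-1` [set 0]).
have mN : measurable N.
  apply: measurableI; first exact: mI.
  apply: measurableC; apply: measurableI.
    by rewrite -[X in measurable X]setTI; exact: mea.
  by rewrite -[X in measurable X]setTI; exact: meb.
have N0 t : P (xsection N t) = 0%E.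
  apply: measure_negligible; first exact: measurable_xsection.
  have [tsT|tsT] := boolP (t \in `[s, T]); last first.
    rewrite (_ : xsection N t = set0); first exact: negligible_set0.
    apply/seteqP; split => // w; rewrite /xsection/= inE => -[/= h _].
    by move: tsT; rewrite h.
  have [st _] : s <= t /\ t <= T by move: tsT; rewrite in_itv/= => /andP[].
  apply: negligibleS (rotated_diff_eq m0 st) => w.
  rewrite /xsection/= inE => -[_ nw] [_ h]; apply: nw; split.
    rewrite /= /ea /= IbE !aE// h cReD cReM [Re (_ +i* _)]/= [Im (_ +i* _)]/=.
    rewrite [Im (cintegral _ _ _)]/=; ring.
  rewrite /= /eb /= IaE !bE// h cImD cImM [Re (_ +i* _)]/= [Im (_ +i* _)]/=.
  rewrite [Re (cintegral _ _ _)]/=; ring.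
apply: ae_imp (ae_ysection_null mN N0) => w w0.
exists (ysection N w); split => //.
  exact: measurable_ysection.
move=> r /= nr; rewrite /ysection/= inE; split => /=.
  by apply: contrapT => h; apply: nr => /h.
move=> [hea heb]; apply: nr => rsT.
have [sr _] : s <= r /\ r <= T by move: rsT; rewrite in_itv/= => /andP[].
move: hea heb; rewrite /ea /eb /= IaE IbE !aE// !bE//.
by move=> /eqP; rewrite subr_eq0 => /eqP h1 /eqP; rewrite subr_eq0 => /eqP h2.
Qed.

(** Validity at almost every time determines the integrals over [s, T]; the equation at the single
    time [T] then transfers the value to [T] itself. *)
Lemma rotated_diff_flow m T : (0 < m)%N -> s < T ->
  {ae P, forall w, rotated_diff m T w =
    Cexp (0 +i* (lambda * (T - s))) * rotated_diff m s w}.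
Proof.
move=> m0 sT.
apply: ae_imp2 (rotated_diff_eq m0 (ltW sT)) (rotated_diff_ae_time T m0).
move=> w [[ir ii] eqT] h.
have [h1 h2] := integral_rotation sT ir ii h.
rewrite eqT /Cexp /= expR0; apply: complex_ext.
  rewrite cReD !cReM [Re (_ +i* _)]/= [Im (_ +i* _)]/= mul0r sub0r !mul1r -h1.
  by [].
rewrite cImD !cImM [Re (_ +i* _)]/= [Im (_ +i* _)]/= mul0r add0r !mul1r -h2.
by [].
Qed.

Lemma mild_diff T : s < T ->
  {ae P, forall w, X T w - Y T w =
    Cexp (0 +i* (lambda * (T - s))) *: S (T - s) (X s w - v w)}.
Proof.
move=> sT.
have h : {ae P, forall w, forall m, (0 < m)%N -> rotated_diff m T w =
    Cexp (0 +i* (lambda * (T - s))) * rotated_diff m s w}.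
  apply/ae_foralln => m; have [m0|m0] := posnP m.
    by rewrite m0; apply: aeW.
  by apply: ae_imp (rotated_diff_flow m0 sT) => w.
apply: ae_imp2 (mild_init Y_mild) h => w Ys hm.
apply: (L2_sine_ext (R := R)) => m m0; have := hm m m0.
rewrite /rotated_diff /rotated_coord Ys -!mulrBr -!L2innerBl => hw.
rewrite L2innerZl (semigroup_coord S_semi) ?subr_ge0 ?ltW//.
transitivity (Cexp (- (T%:C * Lam m)) * (Cexp (T%:C * Lam m) * L2inner (X T w - Y T w) (e m))).
  by rewrite mulrA -CexpD addNr Cexp0 mul1r.
rewrite hw [LHS]mulrCA; congr (_ * _); rewrite mulrA -CexpD; congr (Cexp _ * _).
by rewrite rmorphB/=; ring.
Qed.

End mild.

(** * Scalar estimates for eta *)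

Section scalar_estimates.
Context {R : realType}.
Implicit Types (x y z theta : R).

(** The source of the Taylor bounds below: for either sign of [x], a bound on the derivative gains
    one power of [|x|]. *)
Lemma mvt_origin (f df : R -> R) x : (forall y, is_derive y 1 f (df y)) -> f 0 = 0 ->
  exists2 c, `|c| <= `|x| & f x = df c * x.
Proof.
move=> dfE f0.
have cf : continuous f.
  by move=> y; apply/differentiable_continuous/derivable1_diffP; have [] := dfE y.
have [x0|x0] := leP 0 x.
  have [c] := MVT_segment x0 (fun y _ => dfE y) (continuous_subspaceT cf).
  rewrite f0 !subr0 in_itv/= => /andP[c0 cx] ->; exists c => //.
  by rewrite !ger0_norm.
have [c] := MVT_segment (ltW x0) (fun y _ => dfE y) (continuous_subspaceT cf).
rewrite f0 !sub0r in_itv/= => /andP[c0 cx] h; exists c.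
  by rewrite !ler0_norm ?lerN2// ltW.
by apply: oppr_inj; rewrite h mulrN.
Qed.

Lemma normr_sin_le x : `|sin x| <= `|x|.
Proof.
have [c _ ->] := mvt_origin x (@is_derive_sin R) (sin0 R).
by rewrite normrM ler_piMl// cos_max.
Qed.

Lemma cos_half x : 1 - cos x = 2 * sin (x / 2) ^+ 2.
Proof.
have {1}-> : x = x / 2 + x / 2 by field.
by rewrite cosD -!expr2 cos2sin2; ring.
Qed.

Lemma normr_cosB1 x : `|cos x - 1| = 2 * `|sin (x / 2)| ^+ 2.
Proof.
rewrite distrC cos_half real_normK ?num_real// ger0_norm// mulr_ge0//.
exact: sqr_ge0.
Qed.

Let normr_sin_half_le x : `|sin (x / 2)| <= `|x| / 2.
Proof. by apply: le_trans (normr_sin_le _) _; rewrite normrM (@gtr0_norm _ 2^-1) ?invr_gt0. Qed.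

Lemma normr_cosB1_le x : `|cos x - 1| <= `|x| ^+ 2 / 2.
Proof.
rewrite normr_cosB1.
have := normr_sin_half_le x; have := normr_ge0 (sin (x / 2)); nra.
Qed.

Lemma normr_cosB1_le_lin x : `|cos x - 1| <= `|x|.
Proof.
rewrite normr_cosB1; have := normr_sin_half_le x.
have := normr_ge0 (sin (x / 2)); have := sin_max (x / 2); nra.
Qed.

Let derive_sinB (y : R) : is_derive y 1 (fun x => sin x - x) (cos y - 1).
Proof. by apply: is_derive_eq. Qed.

(** Weaker than the cubic bound near 0, but a product with one more factor [x] then stays at degree
    3, for every real [x]. *)
Lemma normr_sinB_le2 x : `|sin x - x| <= `|x| ^+ 2.
Proof.
have [|c cx ->] := mvt_origin x derive_sinB; first by rewrite sin0 subrr.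
rewrite normrM expr2 ler_wpM2r//; exact: le_trans (normr_cosB1_le_lin _) cx.
Qed.

Lemma normr_sinB_le3 x : `|sin x - x| <= `|x| ^+ 3 / 2.
Proof.
have [|c cx ->] := mvt_origin x derive_sinB; first by rewrite sin0 subrr.
rewrite normrM exprSr mulrAC ler_wpM2r//.
apply: le_trans (normr_cosB1_le _) _; rewrite ler_pM2r ?invr_gt0//.
by rewrite ler_sqr ?nnegrE.
Qed.

Lemma normr_cos_taylor_le x : `|cos x - 1 + x ^+ 2 / 2| <= `|x| ^+ 3.
Proof.
have dc (y : R) : is_derive y 1 (fun x => cos x - 1 + x ^+ 2 / 2) (y - sin y).
  by apply: is_derive_eq; rewrite /GRing.scale/= !mulr0; lra.
have [|c cx ->] := mvt_origin x dc; first by rewrite cos0 subrr expr0n/= mul0r addr0.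
rewrite normrM exprSr ler_wpM2r// -opprB normrN.
by apply: le_trans (normr_sinB_le2 _) _; rewrite ler_sqr ?nnegrE.
Qed.

Lemma expR_ge_quadratic z : 0 <= z -> 1 + z + z ^+ 2 / 2 <= expR z.
Proof.
move=> z0; rewrite -subr_ge0.
have de (y : R) : is_derive y 1 (fun z => expR z - (1 + z + z ^+ 2 / 2)) (expR y - (1 + y)).
  by apply: is_derive_eq; rewrite /GRing.scale/= !mulr0; lra.
have [|c _ ->] := mvt_origin z de; first by rewrite expR0 expr0n/= mul0r !addr0 subrr.
by rewrite mulr_ge0// subr_ge0 expR_ge1Dx.
Qed.

Lemma normc_le_ReIm (w : R[i]) : normc w <= `|Re w| + `|Im w|.
Proof.
rewrite -ler_sqr ?nnegrE ?addr_ge0 ?normc_ge0// normc_sqr sqrrD !real_normK ?num_real//.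
by rewrite addrAC lerDl mulrn_wge0// mulr_ge0.
Qed.

Section eta.
Variables (lambda theta h : R).
Local Notation x := (lambda * h).
Local Notation eta := (Defs.eta lambda theta h).

Let q : R[i] := 1 -i* (theta * lambda * h).

Let normc_q_ge1 : 1 <= normc q.
Proof.
rewrite -ler_sqr ?nnegrE ?normc_ge0// normc_sqr /= expr1n sqrrN.
by rewrite lerDl sqr_ge0.
Qed.

Let q_neq0 : q != 0.
Proof.
apply/eqP => q0; have := normc_q_ge1; rewrite q0 ComplexField.Normc.normc0.
by rewrite ler10.
Qed.

Let eta_q : eta * q = 1 +i* ((1 - theta) * lambda * h).
Proof. by rewrite /Defs.eta mulfVK. Qed.

(** [|eta|^2 = (1 + (1 - theta)^2 x^2) / (1 + theta^2 x^2)], and [(1 - theta)^2 = theta^2 + 2 (1/2 -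
    theta)]. *)
Lemma sqr_normc_eta_le : normc eta ^+ 2 <= 1 + 2 * Num.max (2^-1 - theta) 0 * x ^+ 2.
Proof.
have hN : normc eta ^+ 2 * (1 + (theta * lambda * h) ^+ 2) =
    1 + ((1 - theta) * lambda * h) ^+ 2.
  have q2 : normc q ^+ 2 = 1 + (theta * lambda * h) ^+ 2.
    by rewrite normc_sqr /= sqrrN expr1n.
  by rewrite -q2 -exprMn -normcM eta_q normc_sqr /= expr1n.
set m := Num.max _ _.
have m0 : 0 <= m by rewrite /m le_max lexx orbT.
have m1 : 2^-1 - theta <= m by rewrite /m le_max lexx.
have x0 := sqr_ge0 x; have t0 := sqr_ge0 (theta * lambda * h).
rewrite -(ler_pM2r (_ : 0 < 1 + (theta * lambda * h) ^+ 2)); last by lra.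
rewrite hN.
have p1 : 0 <= m * x ^+ 2 * (theta * lambda * h) ^+ 2.
  by apply: mulr_ge0 => //; exact: mulr_ge0.
have p2 : 0 <= (m - (2^-1 - theta)) * x ^+ 2.
  by apply: mulr_ge0 => //; rewrite subr_ge0.
have -> : ((1 - theta) * lambda * h) ^+ 2 =
    (theta * lambda * h) ^+ 2 + 2 * (2^-1 - theta) * x ^+ 2 by field.
move: (x ^+ 2) (theta * _ * _) p1 p2 => X Y; lra.
Qed.

Lemma normc_eta_le : 0 <= theta <= 1 -> normc eta <= 1 + `|x|.
Proof.
move=> /andP[t0 t1].
rewrite -ler_sqr ?nnegrE ?addr_ge0 ?normc_ge0//.
apply: (le_trans sqr_normc_eta_le).
rewrite sqrrD expr1n mul1r real_normK ?num_real// -addrA lerD2l.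
have m1 : Num.max (2^-1 - theta) 0 <= 2^-1 by rewrite ge_max invr_ge0 ler0n andbT; lra.
have := sqr_ge0 x; have := normr_ge0 x.
move: (Num.max _ _) m1 (x ^+ 2) `|x| => m m1 X Y; nra.
Qed.

Lemma normc_exp_eta_le : 0 <= theta <= 1 ->
  normc (Cexp (0 +i* x) - eta) <= `|2 * theta - 1| * x ^+ 2 + 3 * `|x| ^+ 3.
Proof.
move=> /andP[t0 t1].
have t1' : `|theta| <= 1 by rewrite ger0_norm.
(* The denominator [q] of [eta] has modulus at least 1, so clearing it can only increase the
   left-hand side. *)
apply: (@le_trans _ _ (normc ((Cexp (0 +i* x) - eta) * q))).
  by rewrite normcM ler_peMr// normc_ge0.
apply: (le_trans (normc_le_ReIm _)).
rewrite mulrBl eta_q /Cexp /= expR0 !mul1r.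
set s := sin x; set c := cos x.
(* [(theta - 1/2) x^2] is the leading local error of the scheme. The rest is cubic: two terms of
   size [|x|^3] here and two halves in the imaginary part, whence the constant 3. *)
have -> : c * 1 - s * - (theta * lambda * h) - 1 =
    (c - 1 + x ^+ 2 / 2) + theta * x * (s - x) + (theta - 2^-1) * x ^+ 2 by field.
have -> : c * - (theta * lambda * h) + s * 1 - (1 - theta) * lambda * h =
    (s - x) - theta * x * (c - 1) by ring.
have h1 := normr_cos_taylor_le x; have h2 := normr_sinB_le2 x.
have h3 := normr_sinB_le3 x; have h4 := normr_cosB1_le x.
have x0 := normr_ge0 x.
have b1 : `|theta * x * (s - x)| <= `|x| ^+ 3.
  rewrite normrM exprS ler_pM// normrM; exact: ler_piMl.
have b2 : `|theta * x * (c - 1)| <= `|x| ^+ 3 / 2.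
  rewrite normrM exprS -mulrA ler_pM// normrM; exact: ler_piMl.
have b3 : `|(theta - 2^-1) * x ^+ 2| <= `|2 * theta - 1| * x ^+ 2.
  rewrite normrM (ger0_norm (sqr_ge0 _)) ler_wpM2r ?sqr_ge0//.
  have -> : 2 * theta - 1 = 2 * (theta - 2^-1) by field.
  by rewrite normrM (@ger0_norm _ 2)// ler_peMl// ler1n.
have c1 := ler_normD (c - 1 + x ^+ 2 / 2 + theta * x * (s - x)) ((theta - 2^-1) * x ^+ 2).
have c2 := ler_normD (c - 1 + x ^+ 2 / 2) (theta * x * (s - x)).
have c3 := ler_normB (s - x) (theta * x * (c - 1)).
lra.
Qed.

End eta.

(* Here [z = alpha dT] and [E = exp z].  Estimating [1 - rho] from below through
   [E^2 - |eta|^2] directly would lose a factor [E], hence the detour through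
   [1 + 2 z + 2 z^2], which is at most both [E^2] and [4 E]. *)
Lemma contraction_gap z rho E : 0 < z -> 0 <= rho -> 0 < E ->
  1 + z + z ^+ 2 / 2 <= E -> 1 + 2 * z + 2 * z ^+ 2 <= E ^+ 2 ->
  (rho * E) ^+ 2 <= 1 + 2 * z ^+ 2 -> rho < 1 /\ z <= 4 * E * (1 - rho).
Proof.
move=> z0 r0 E0 hE hE2 hr.
set D := 1 + 2 * z + 2 * z ^+ 2.
have D0 : 0 < D by rewrite /D; have := sqr_ge0 z; lra.
have r2 : rho ^+ 2 * D <= D - 2 * z.
  apply: (@le_trans _ _ (rho ^+ 2 * E ^+ 2)); first by rewrite ler_wpM2l ?sqr_ge0.
  by rewrite -exprMn /D; lra.
have r1 : rho < 1.
  rewrite -(@ltr_pXn2r _ 2)// ?nnegrE// expr1n -(ltr_pM2r D0); lra.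
split => //.
(* [2 z <= (1 - rho^2) D = (1 - rho) (1 + rho) D], and [1 + rho <= 2]. *)
have g : z <= (1 - rho) * D.
  have : 2 * z <= (1 - rho) * (1 + rho) * D.
    have -> : (1 - rho) * (1 + rho) * D = D - rho ^+ 2 * D by ring.
    lra.
  have : (1 - rho) * (1 + rho) * D <= (1 - rho) * 2 * D.
    by rewrite ler_pM2r// ler_pM2l ?subr_gt0//; lra.
  lra.
have DE : D <= 4 * E by rewrite /D; have := sqr_ge0 z; lra.
apply: (le_trans g); rewrite mulrC ler_wpM2r// subr_ge0; exact: ltW.
Qed.

End scalar_estimates.

(** * Recursion for the parareal errors *)

Section recursion.
Context {R : realType}.

(** [g] is a supersolution of the linear recursion with source [a], and its bound [L] is the factor
    gained per iteration: an induction on [n] inside the one on [k] gives [e (k+1) n <= g n L^k M].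
    It serves with [g] constant on unbounded time and with a growing [g] on a bounded range [p]. *)
Lemma parareal_recursion (e : nat -> nat -> \bar R) (p : nat -> Prop) (g : nat -> R)
    (a rho L M : R) :
  (forall n, p n.+1 -> p n) -> 0 <= a -> 0 <= rho -> 0 <= M ->
  (forall k, e k 0%N = 0%E) ->
  (forall k n, (e k.+1 n.+1 <= a%:E * e k n + rho%:E * e k.+1 n)%E) ->
  (forall n, 0 <= g n) -> (forall n, p n -> g n <= L) ->
  (forall n, a + rho * g n <= g n.+1) ->
  (forall n, p n -> (e 0%N n <= M%:E)%E) ->
  forall k n, p n -> (e k n <= (L ^+ k * M)%:E)%E.
Proof.
move=> pS a0 r0 M0 e0 eS g0 gL gS eM; elim=> [|k IH] n pn.
  by rewrite expr0 mul1r; exact: eM.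
have Ln j : p j -> 0 <= L by move=> /gL; apply: le_trans.
have LM : 0 <= L ^+ k * M by rewrite mulr_ge0// exprn_ge0// (Ln n).
suff h j : p j -> (e k.+1 j <= (g j * (L ^+ k * M))%:E)%E.
  apply: (le_trans (h n pn)); rewrite lee_fin exprS -mulrA ler_wpM2r//; exact: gL.
elim: j => [_|j IHj pj]; first by rewrite e0 lee_fin mulr_ge0.
apply: (le_trans (eS k j)).
apply: (@le_trans _ _ (a%:E * (L ^+ k * M)%:E + rho%:E * (g j * (L ^+ k * M))%:E)%E).
  by apply: leeD; apply: lee_wpmul2l; rewrite ?lee_fin//; [apply: IH|apply: IHj]; exact: pS.
rewrite -!EFinM -EFinD lee_fin (mulrA rho) -mulrDl ler_wpM2r//; exact: gS.
Qed.

(** Only a finite supremum needs work: if it is infinite, so is the right-hand side, as [c > 0]. *)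
Lemma ereal_sup_scale_le (A : set nat) (f g : nat -> \bar R) (c : R) :
  0 < c -> (exists n, A n) -> (forall n, (0 <= g n)%E) ->
  (forall M : R, 0 <= M -> (forall n, A n -> (g n <= M%:E)%E) ->
    forall n, A n -> (f n <= (c * M)%:E)%E) ->
  (ereal_sup [set f n | n in A] <= c%:E * ereal_sup [set g n | n in A])%E.
Proof.
move=> c0 [i Ai] g0 h; set s := ereal_sup [set g n | n in A].
have gs n : A n -> (g n <= s)%E by move=> An; apply: ereal_sup_ubound; exists n.
have s0 : (0 <= s)%E by exact: le_trans (g0 i) (gs i Ai).
case: s s0 gs => [r| |] s0 gs; last by [].
- apply: ge_ereal_sup => _ [n An <-]; rewrite -EFinM; apply: h => //.
- by rewrite gt0_muley ?lte_fin// leey.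
Qed.

(** A sum is at most twice its larger term, and [delta^k <= delta] for [k >= 1]. This is why only
    the first power of [|2 theta - 1|] survives. The [+ 1] makes the constant positive. *)
Lemma rate_pow (L C1 delta h : R) k : 0 <= delta <= 1 -> 0 <= h -> 0 <= C1 -> 0 <= L ->
  L <= C1 * (delta * h + h ^+ 2) ->
  L ^+ k <= ((2 * C1) ^+ k + 1) * (delta * h ^+ k + h ^+ (2 * k)).
Proof.
move=> /andP[d0 d1] h0 C10 L0 hL.
have hk0 : 0 <= h ^+ k by exact: exprn_ge0.
have h2k0 : 0 <= h ^+ (2 * k) by exact: exprn_ge0.
have C2 : 0 <= (2 * C1) ^+ k by apply: exprn_ge0; rewrite mulr_ge0.
have dh0 : 0 <= delta * h ^+ k by rewrite mulr_ge0.
case: k hk0 h2k0 C2 dh0 => [|k] hk0 h2k0 C2 dh0.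
  by rewrite muln0 !expr0 mulr1; lra.
apply: (@le_trans _ _ ((2 * C1) ^+ k.+1 * (delta * h ^+ k.+1 + h ^+ (2 * k.+1)))); last first.
  by rewrite ler_wpM2r ?addr_ge0// lerDl.
have mx : L <= 2 * C1 * Num.max (delta * h) (h ^+ 2).
  have mm : delta * h + h ^+ 2 <= 2 * Num.max (delta * h) (h ^+ 2).
    by rewrite mulr_natl mulr2n lerD// le_max lexx ?orbT.
  by apply: (le_trans hL); rewrite (mulrC 2) -mulrA; exact: ler_wpM2l.
have mx0 : 0 <= Num.max (delta * h) (h ^+ 2) by rewrite le_max mulr_ge0.
apply: (@le_trans _ _ ((2 * C1 * Num.max (delta * h) (h ^+ 2)) ^+ k.+1)).
  by rewrite ler_pXn2r ?nnegrE// !mulr_ge0.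
rewrite exprMn ler_wpM2l//.
have dk : delta ^+ k.+1 <= delta by rewrite exprS ler_piMr// exprn_ile1.
case: (leP (delta * h) (h ^+ 2)) => _.
  by rewrite -exprM lerDr.
rewrite exprMn; apply: (@le_trans _ _ (delta * h ^+ k.+1)); last by rewrite lerDl.
by rewrite ler_wpM2r.
Qed.

(** * Size of the two coefficients of the recursion *)

Section rates.
Variables (alpha lambda theta h : R).
Hypotheses (alpha_ge0 : 0 <= alpha) (theta01 : 0 <= theta <= 1) (h_gt0 : 0 < h).
Local Notation eta := (Defs.eta lambda theta h).

(** The decay of [S] is kept in this coefficient as well: in [step_contraction] it cancels the
    factor [exp (alpha h)] by which the gap [1 - step_growth] may be small for large [h]. *)
Definition step_defect := normc (Cexp (0 +i* (lambda * h)) - eta) * expR (- (alpha * h)).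
Definition step_growth := normc eta * expR (- (alpha * h)).

Lemma step_defect_ge0 : 0 <= step_defect.
Proof. by rewrite mulr_ge0 ?normc_ge0 ?expR_ge0. Qed.

Lemma step_growth_ge0 : 0 <= step_growth.
Proof. by rewrite mulr_ge0 ?normc_ge0 ?expR_ge0. Qed.

Lemma step_defect_le_local :
  step_defect <= lambda ^+ 2 * h ^+ 2 + 3 * `|lambda| ^+ 3 * h ^+ 3.
Proof.
apply: (@le_trans _ _ (normc (Cexp (0 +i* (lambda * h)) - eta))).
  rewrite ler_piMr ?normc_ge0// -expR0 ler_expR oppr_le0 mulr_ge0//; exact: ltW.
apply: (le_trans (normc_exp_eta_le lambda h theta01)).
apply: lerD; last by rewrite normrM (gtr0_norm h_gt0) exprMn mulrA.
rewrite exprMn ler_piMl//; first by apply: mulr_ge0; exact: sqr_ge0.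
by rewrite ler_norml; move/andP: theta01 => [] *; lra.
Qed.

Lemma step_growth_le : step_growth <= 1 + `|lambda| * h.
Proof.
apply: (@le_trans _ _ (normc eta)).
  rewrite ler_piMr ?normc_ge0// -expR0 ler_expR oppr_le0 mulr_ge0//; exact: ltW.
by apply: (le_trans (normc_eta_le _ _ theta01)); rewrite normrM (gtr0_norm h_gt0).
Qed.

(** The defect is of order [|2 theta - 1| h^2 + h^3], and dividing by a gap of order [alpha h] costs
    one power of [h]. The bound holds for every [h > 0], not only for small steps. *)
Lemma step_contraction : Num.sqrt (Num.max (2^-1 - theta) 0) * `|lambda| < alpha ->
  step_growth < 1 /\
  step_defect / (1 - step_growth) <=
    4 / alpha * (lambda ^+ 2 + 3 * `|lambda| ^+ 3) * (`|2 * theta - 1| * h + h ^+ 2).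
Proof.
set m := Num.max _ _ => ma.
have m0 : 0 <= m by rewrite /m le_max lexx orbT.
have alpha_gt0 : 0 < alpha by apply: le_lt_trans ma; rewrite mulr_ge0// sqrtr_ge0.
have z0 : 0 < alpha * h by rewrite mulr_gt0.
have ml : m * lambda ^+ 2 <= alpha ^+ 2.
  have : (Num.sqrt m * `|lambda|) ^+ 2 <= alpha ^+ 2.
    by rewrite ler_sqr ?nnegrE ?mulr_ge0 ?sqrtr_ge0// ltW.
  by rewrite exprMn sqr_sqrtr// real_normK ?num_real.
have E0 : 0 < expR (alpha * h) by exact: expR_gt0.
have gE : step_growth * expR (alpha * h) = normc eta.
  by rewrite /step_growth expRN mulfVK// gt_eqF.
have [] := @contraction_gap R (alpha * h) step_growth (expR (alpha * h)) z0
  step_growth_ge0 E0.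
- exact: expR_ge_quadratic (ltW z0).
- have -> : expR (alpha * h) ^+ 2 = expR (alpha * h + alpha * h) by rewrite expr2 expRD.
  apply: le_trans (expR_ge_quadratic _); last by rewrite addr_ge0// ltW.
  by rewrite le_eqVlt; apply/orP; left; apply/eqP; field.
- rewrite gE; apply: (le_trans (sqr_normc_eta_le _ _ _)).
  rewrite -/m lerD2l -mulrA ler_pM2l// !exprMn mulrA ler_wpM2r ?sqr_ge0//.
move=> g1 gap; split => //.
have p : 0 < 1 - step_growth by rewrite subr_gt0.
rewrite ler_pdivrMr//.
have b := normc_exp_eta_le lambda h theta01.
set A := `|2 * theta - 1| * (lambda * h) ^+ 2 + 3 * `|lambda * h| ^+ 3 in b.
have A0 : 0 <= A by exact: le_trans (normc_ge0 _) b.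
apply: (@le_trans _ _ (A * expR (- (alpha * h)))).
  by rewrite ler_wpM2r ?expR_ge0.
have g2 : expR (- (alpha * h)) <= 4 / (alpha * h) * (1 - step_growth).
  rewrite expRN -(ler_pM2l E0) mulfV ?gt_eqF// -(ler_pM2r z0) mul1r.
  apply: (le_trans gap); rewrite le_eqVlt; apply/orP; left; apply/eqP.
  by field; rewrite !gt_eqF.
apply: (@le_trans _ _ (A * (4 / (alpha * h) * (1 - step_growth)))); first exact: ler_wpM2l.
rewrite mulrA ler_pM2r//.
have -> : A * (4 / (alpha * h)) = 4 / alpha * (A / h) by field; rewrite !gt_eqF.
rewrite -[leRHS]mulrA ler_pM2l ?divr_gt0//.
rewrite ler_pdivrMr// /A normrM (gtr0_norm h_gt0).
set dl := `|2 * theta - 1|; set l := `|lambda|.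
have -> : (lambda * h) ^+ 2 = l ^+ 2 * h ^+ 2 by rewrite exprMn real_normK ?num_real.
have -> : lambda ^+ 2 = l ^+ 2 by rewrite real_normK ?num_real.
have d0 : 0 <= dl by exact: normr_ge0.
have l0 : 0 <= l by exact: normr_ge0.
have q1 : 0 <= l ^+ 2 * h ^+ 3 by rewrite mulr_ge0 ?exprn_ge0// ltW.
have q2 : 0 <= l ^+ 3 * (dl * h ^+ 2) by rewrite !mulr_ge0 ?exprn_ge0// ltW.
have -> : (l ^+ 2 + 3 * l ^+ 3) * (dl * h + h ^+ 2) * h =
  dl * (l ^+ 2 * h ^+ 2) + 3 * (l * h) ^+ 3 + (l ^+ 2 * h ^+ 3 + 3 * (l ^+ 3 * (dl * h ^+ 2))).
  by ring.
by rewrite lerDl addr_ge0// mulr_ge0.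
Qed.

End rates.

End recursion.

(** * The parareal errors in L^2(Omega; H) *)

Section parareal_error.
Context {R : realType} {d : measure_display} {Om : measurableType d}.
Variable P : probability Om R.
Local Notation H := (L2C R).
Variables (alpha lambda theta dT : R) (B : R -> set (set Om)).
Variables (beta : nat -> R -> Om -> R[i]) (S : R -> H -> H).
Variables (Q Qh : {linear H -> H}) (u0 : Om -> H) (u : R -> Om -> H).
Variable U : nat -> nat -> Om -> H.
Hypothesis alpha_ge0 : 0 <= alpha.
Hypothesis dT_gt0 : 0 < dT.
Hypothesis sp : schrodinger_problem alpha lambda P B beta S Q Qh u0 u.
Hypothesis pr : parareal P B beta S Qh lambda theta dT u0 U.
Local Notation eta := (Defs.eta lambda theta dT).

Definition parareal_error k n w := u (n%:R * dT) w - U k n w.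

Let S_semi := sp_semigroup sp.
Let time_ge0 n : 0 <= n%:R * dT. Proof. by rewrite mulr_ge0// ltW. Qed.

(** Measurability of an iterate is not among the fields of [parareal]; it comes from the adapted
    exact solution that the next correction starts at [U k n], which equals [U k n] almost surely at
    its initial time. *)
Lemma parareal_wm k n : weakly_measurable setT (U k n).
Proof.
have [w [Y mY _] _] := pr_correct pr k n.
apply: (ae_eq_weakly_measurable (cf_complete (sp_filtration sp)) _
  (mild_wm (sp_filtration sp) (time_ge0 n) (lexx _) mY)).
by apply: ae_imp (mild_init S_semi mY) => o ->.
Qed.

Lemma parareal_error_wm k n : weakly_measurable setT (parareal_error k n).
Proof.
apply: weakly_measurableB; last exact: parareal_wm.
exact: (mild_wm (sp_filtration sp) (lexx 0) (time_ge0 n) (sp_mild sp)).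
Qed.

Lemma parareal_error0 k : L2Om_norm P (parareal_error k 0) = 0%E.
Proof.
have e0 : {ae P, forall w, parareal_error k 0 w = (fun=> 0) w}.
  apply: ae_imp (mild_init S_semi (sp_mild sp)) => w uw.
  by rewrite /parareal_error mul0r uw (pr_init pr) subrr.
rewrite (eq_ae_L2Om_norm S_semi (parareal_error_wm k 0) (weakly_measurable_cst _ _) e0).
rewrite /L2Om_norm (_ : EFin \o _ \o _ = cst 0%E); last first.
  by apply/funext => w /=; rewrite L2norm0.
exact: Lnorm0.
Qed.

Lemma parareal_error_rec k n : {ae P, forall w,
  parareal_error k.+1 n.+1 w =
    (Cexp (0 +i* (lambda * dT)) - eta) *: S dT (parareal_error k n w) +
    eta *: S dT (parareal_error k.+1 n w)}.
Proof.
have [v [Y mY vY] hU] := pr_correct pr k n.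
have nn1 : n%:R * dT < n.+1%:R * dT by rewrite ltr_pM2r// ltr_nat.
have step : n.+1%:R * dT - n%:R * dT = dT by rewrite -mulrBl -natr1 addrAC subrr add0r mul1r.
have := mild_diff alpha_ge0 S_semi (sp_filtration sp) (sp_wiener sp) (sp_mild sp)
  (time_ge0 n) mY nn1.
rewrite step => h; apply: ae_imp3 h vY hU => w hd vw Uw.
have dT0 := ltW dT_gt0.
(* The coarse correction only sees [U (k+1) n - U k n], which is a difference of two errors. *)
have E1 : S dT (parareal_error k.+1 n w) =
    S dT (parareal_error k n w) - (S dT (U k.+1 n w) - S dT (U k n w)).
  rewrite /parareal_error !(semigroupB S_semi)//.
  by rewrite opprB addrA subrK.
rewrite E1 scalerBl scalerBr addrA subrK -hd.
by rewrite {1}/parareal_error Uw vw -scalerBr opprD addrA addrAC.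
Qed.

Lemma parareal_error_norm_rec k n : (L2Om_norm P (parareal_error k.+1 n.+1) <=
  (step_defect alpha lambda theta dT)%:E * L2Om_norm P (parareal_error k n) +
  (step_growth alpha lambda theta dT)%:E * L2Om_norm P (parareal_error k.+1 n))%E.
Proof.
apply: (L2Om_norm_lin S_semi); try exact: parareal_error_wm.
- exact: step_defect_ge0.
- exact: step_growth_ge0.
have dT0 := ltW dT_gt0.
apply: ae_imp (parareal_error_rec k n) => w ->.
apply: le_trans (L2normD _ _) _; rewrite !L2normZ.
by apply: lerD; rewrite -mulrA ler_wpM2l ?normc_ge0//; exact: semigroup_contr.
Qed.

Lemma parareal_error_bound (p : nat -> Prop) (g : nat -> R) (L M : R) :
  (forall n, p n.+1 -> p n) -> 0 <= M ->
  (forall n, 0 <= g n) -> (forall n, p n -> g n <= L) ->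
  (forall n, step_defect alpha lambda theta dT +
     step_growth alpha lambda theta dT * g n <= g n.+1) ->
  (forall n, p n -> (L2Om_norm P (parareal_error 0 n) <= M%:E)%E) ->
  forall k n, p n -> (L2Om_norm P (parareal_error k n) <= (L ^+ k * M)%:E)%E.
Proof.
move=> pS M0 g0 gL gS eM.
apply: (@parareal_recursion R (fun k n => L2Om_norm P (parareal_error k n)) p g
  (step_defect alpha lambda theta dT) (step_growth alpha lambda theta dT) L M) => //.
- exact: step_defect_ge0.
- exact: step_growth_ge0.
- exact: parareal_error0.
- exact: parareal_error_norm_rec.
Qed.

End parareal_error.

(** * Choice of the constants on unbounded and bounded time *)

Unset Implicit Arguments.

Theorem theorem3p2 (R : realType) (alpha lambda theta : R)
    (alpha_ge0 : 0 <= alpha) (theta_ge0 : 0 <= theta) (theta_le1 : theta <= 1) :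
  (Num.sqrt (Num.max (2^-1 - theta) 0) * `|lambda| < alpha ->
   forall k : nat,
   exists2 C : R, 0 < C &
   forall (d : measure_display) (Om : measurableType d) (P : probability Om R)
     (B : R -> set (set Om)) (beta : nat -> R -> Om -> R[i])
     (S : R -> L2C R -> L2C R) (Q Qh : {linear L2C R -> L2C R})
     (u0 : Om -> L2C R) (u : R -> Om -> L2C R),
   schrodinger_problem alpha lambda P B beta S Q Qh u0 u ->
   forall (dT : R) (U : nat -> nat -> Om -> L2C R),
   0 < dT -> lambda * dT < 1 ->
   parareal P B beta S Qh lambda theta dT u0 U ->
   (ereal_sup [set L2Om_norm P (fun w => (u (n%:R * dT) w - U k n w)%R)
              | n in [set: nat]] <=
    (C * (`|2 * theta - 1| * dT ^+ k + dT ^+ (2 * k)))%:E *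
    ereal_sup [set L2Om_norm P (fun w => (u (n%:R * dT) w - U 0%N n w)%R)
              | n in [set: nat]])%E)
  /\
  (alpha <= Num.sqrt (Num.max (2^-1 - theta) 0) * `|lambda| ->
   forall (d : measure_display) (Om : measurableType d) (P : probability Om R)
     (B : R -> set (set Om)) (beta : nat -> R -> Om -> R[i])
     (S : R -> L2C R -> L2C R) (Q Qh : {linear L2C R -> L2C R})
     (u0 : Om -> L2C R) (u : R -> Om -> L2C R),
   schrodinger_problem alpha lambda P B beta S Q Qh u0 u ->
   forall (k : nat) (T : R),
   exists2 C : R, 0 < C &
   forall (dT : R) (N : nat) (U : nat -> nat -> Om -> L2C R),
   0 < dT -> lambda * dT < 1 -> N%:R * dT = T ->
   parareal P B beta S Qh lambda theta dT u0 U ->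
   (ereal_sup [set L2Om_norm P (fun w => (u (n%:R * dT) w - U k n w)%R)
              | n in [set n : nat | (n <= N)%N]] <=
    (C * dT ^+ k)%:E *
    ereal_sup [set L2Om_norm P (fun w => (u (n%:R * dT) w - U 0%N n w)%R)
              | n in [set n : nat | (n <= N)%N]])%E).
Proof.
have theta01 : 0 <= theta <= 1 by rewrite theta_ge0.
have dl01 : 0 <= `|2 * theta - 1| <= 1.
  by rewrite normr_ge0 ler_norml; apply/andP; split; lra.
split=> [ma k|_ d Om P B beta S Q Qh u0 u sp k T].
  have alpha_gt0 : 0 < alpha by apply: le_lt_trans ma; rewrite mulr_ge0// sqrtr_ge0.
  pose C1 := 4 / alpha * (lambda ^+ 2 + 3 * `|lambda| ^+ 3).
  have C10 : 0 <= C1.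
    apply: mulr_ge0; first by rewrite divr_ge0.
    by apply: addr_ge0; [exact: sqr_ge0|rewrite mulr_ge0// exprn_ge0].
  exists ((2 * C1) ^+ k + 1).
    by rewrite ltr_wpDl// exprn_ge0// mulr_ge0.
  move=> d Om P B beta S Q Qh u0 u sp dT U dT0 _ pr.
  have [g1 rate] := step_contraction alpha_ge0 theta01 dT0 ma.
  apply: ereal_sup_scale_le => [||n|M M0 hM n _].
  - have dl := normr_ge0 (2 * theta - 1).
    rewrite mulr_gt0//; first by rewrite ltr_wpDl// exprn_ge0// mulr_ge0.
    by rewrite ltr_wpDl ?exprn_gt0// mulr_ge0// exprn_ge0// ltW.
  - by exists 0%N.
  - exact: L2Om_norm_ge0.
  (* The fixed point of [g = step_defect + step_growth * g]: the constant sequence [L] is an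
     admissible supersolution for all times. *)
  set L := step_defect alpha lambda theta dT / (1 - step_growth alpha lambda theta dT) in rate.
  have p : 0 < 1 - step_growth alpha lambda theta dT by rewrite subr_gt0.
  have L0 : 0 <= L by rewrite divr_ge0 ?step_defect_ge0// ltW.
  have := @parareal_error_bound R d Om P alpha lambda theta dT B beta S Q Qh u0 u U
    alpha_ge0 dT0 sp pr (fun=> True) (fun=> L) L M.
  move=> /(_ (fun _ _ => I) M0 (fun=> L0) (fun _ _ => lexx L)) bound.
  apply: le_trans (bound _ _ k n I) _.
  - move=> _; rewrite le_eqVlt; apply/orP; left; apply/eqP.
    by rewrite /L; field; rewrite gt_eqF.
  - by move=> j _; exact: hM.
  rewrite lee_fin ler_wpM2r//; exact: (rate_pow k dl01 (ltW dT0) C10 L0 rate).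
(* A bound for [N r^N a / dT] when [N dT = T]: [r^N <= exp (|lambda| T)], [N dT^2 = T dT], and
   [N dT^3 <= T^2 dT]. Absolute values keep it nonnegative for any real [T]. *)
pose C0 := expR (`|lambda| * `|T|) * (`|T| * lambda ^+ 2 + 3 * `|lambda| ^+ 3 * `|T| ^+ 2).
have C00 : 0 <= C0.
  apply: mulr_ge0; first exact: expR_ge0.
  apply: addr_ge0; first exact: mulr_ge0 (normr_ge0 _) (sqr_ge0 _).
  by apply: mulr_ge0; [rewrite mulr_ge0// exprn_ge0|exact: sqr_ge0].
exists (C0 ^+ k + 1); first by rewrite ltr_wpDl// exprn_ge0.
move=> dT N U dT0 _ NT pr.
apply: ereal_sup_scale_le => [||n|M M0 hM n nN].
- by rewrite mulr_gt0 ?exprn_gt0// ltr_wpDl// exprn_ge0.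
- by exists 0%N.
- exact: L2Om_norm_ge0.
set a := step_defect alpha lambda theta dT.
have a0 : 0 <= a by exact: step_defect_ge0.
pose r := 1 + `|lambda| * dT.
have r1 : 1 <= r by rewrite lerDl mulr_ge0// ltW.
have r0 : 0 <= r by exact: le_trans r1.
(* An upper bound for the discrete Gronwall sum of [a r^i] over [i < j], valid since [r >= 1]. *)
pose g (j : nat) := j%:R * r ^+ j * a.
have rn0 j : 0 <= r ^+ j by exact: exprn_ge0.
have g0 j : 0 <= g j by apply: mulr_ge0 => //; exact: mulr_ge0.
have T0 : 0 <= T by rewrite -NT mulr_ge0// ltW.
have gN j : (j <= N)%N -> g j <= C0 * dT.
  move=> jN; apply: (@le_trans _ _ (g N)).
    rewrite /g ler_wpM2r// ler_pM ?exprn_ge0 ?ler_nat//.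
    by rewrite ler_weXn2l.
  have rN : r ^+ N <= expR (`|lambda| * `|T|).
    rewrite (ger0_norm T0) -NT mulrCA expRM_natl.
    apply: lerXn2r; rewrite ?nnegrE ?expR_ge0//; exact: expR_ge1Dx.
  have Na : N%:R * a <= (`|T| * lambda ^+ 2 + 3 * `|lambda| ^+ 3 * `|T| ^+ 2) * dT.
    rewrite (ger0_norm T0).
    apply: (@le_trans _ _ (N%:R * (lambda ^+ 2 * dT ^+ 2 + 3 * `|lambda| ^+ 3 * dT ^+ 3))).
      by rewrite ler_wpM2l//; exact: step_defect_le_local.
    have -> : N%:R * (lambda ^+ 2 * dT ^+ 2 + 3 * `|lambda| ^+ 3 * dT ^+ 3) =
      (T * lambda ^+ 2 + 3 * `|lambda| ^+ 3 * (T * dT)) * dT by rewrite -NT; ring.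
    rewrite ler_wpM2r ?(ltW dT0)// lerD2l ler_wpM2l ?mulr_ge0 ?exprn_ge0//.
    (* [dT <= T] requires at least one step; for [N = 0] both sides vanish together with [T]. *)
    case: (N) NT => [|N'] NT; first by rewrite -NT !mul0r expr0n.
    by rewrite expr2 ler_wpM2l// -NT ler_peMl ?(ltW dT0)// ler1n.
  have -> : g N = r ^+ N * (N%:R * a) by rewrite /g; ring.
  by rewrite /C0 -[leRHS]mulrA; apply: ler_pM => //; exact: mulr_ge0.
have bound := @parareal_error_bound R d Om P alpha lambda theta dT B beta S Q Qh u0 u U
    alpha_ge0 dT0 sp pr (fun j => (j <= N)%N) g (C0 * dT) M
    (fun j => @ltnW j N) M0 g0 gN _ _ k n nN.
apply: le_trans (bound _ _) _.
- move=> j; rewrite /g -/a exprS -natr1.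
  have h1 : 1 <= r ^+ j by rewrite exprn_ege1.
  have h2 : step_growth alpha lambda theta dT <= r by exact: step_growth_le.
  rewrite -subr_ge0.
  have -> : (j%:R + 1) * (r * r ^+ j) * a -
      (a + step_growth alpha lambda theta dT * (j%:R * r ^+ j * a)) =
      (r * r ^+ j - 1) * a +
      (r - step_growth alpha lambda theta dT) * (j%:R * r ^+ j * a) by ring.
  by rewrite addr_ge0// mulr_ge0 ?subr_ge0 ?mulr_ege1//; exact: g0.
- by move=> j jN; exact: hM.
rewrite lee_fin ler_wpM2r// exprMn ler_wpM2r ?exprn_ge0 ?(ltW dT0)//.
by rewrite lerDl.
Qed.
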